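(* Let $A$ be a commutative ring, let $f(x)=x^{2n}+b_2x^{2n-2}+\dots+b_{2n-2}x^2+b_{2n}\in A[x]$ be a monic polynomial with no terms of odd degree, and let $r,n_1,\dots,n_r\in\mathbb N$ with $n_1+\dots+n_r\le n$. Let $S/J=\mathrm{PF}^{\mathrm{iso}}_{n_1,\dots,n_r}(f)$. Then the lead term ideal of $J$ is $$\ell(J)=\mathrm{Sq}\big(\langle c_{11},\dots,c_{1n_1}\rangle^{n-n_r-\dots-n_1+1}\big)+\mathrm{Sq}\big(\langle c_{21},\dots,c_{2n_2}\rangle^{n-n_r-\dots-n_2+1}\big)+\dots+\mathrm{Sq}\big(\langle c_{r1},\dots,c_{rn_r}\rangle^{n-n_r+1}\big).$$
   Context: For a monic polynomial $g(x)$ of degree $m$ put $g^*(x):=(-1)^mg(-x)$. Define $\mathrm{PF}^{\mathrm{iso}}_{n_1,\dots,n_r}(f):=S/J$, where $S=A[c_{1,1},\dots,c_{1,n_1};\dots;c_{r,1},\dots,c_{r,n_r}]$, $g_i(x)=x^{n_i}+c_{i,1}x^{n_i-1}+\dots+c_{i,n_i}\in S[x]$, and $J\subseteq S$ is the ideal generated by the coefficients of the remainder of $f(x)$ upon division by $g_1(x)\cdots g_r(x)g_r^*(x)\cdots g_1^*(x)$ in $S[x]$. Set $\deg c_{i,j}=j$. The monomials of $S$ are ordered by the block ordering $[c_{1,1},\dots,c_{1,n_1}]\gg\dots\gg[c_{r,1},\dots,c_{r,n_r}]$ arising from the graded reverse lexicographic ordering with $c_{i,1}>\dots>c_{i,n_i}$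 on each block. Here the graded reverse lexicographic ordering on $[c_1,\dots,c_m]$ with $\deg c_i=i$ is: $c^\alpha>c^\gamma$ iff $\sum_i i\alpha_i>\sum_i i\gamma_i$, or $\sum_i i\alpha_i=\sum_i i\gamma_i$ and for some $l$ one has $\alpha_l<\gamma_l$ and $\alpha_k=\gamma_k$ for all $k>l$. The block ordering $[x]\gg[t]$ is: $x^\alpha t^\beta<x^\gamma t^\delta$ iff $x^\alpha<x^\gamma$, or $x^\alpha=x^\gamma$ and $t^\beta<t^\delta$ (iterated for several blocks, the leftmost block being compared first). $\ell(J)$ is the ideal generated by the lead terms (lead coefficient times lead monomial) of the nonzero elements of $J$. For a monomial ideal $I$, $\mathrm{Sq}\,I$ is the monomial ideal generated by the squares of the monomials in $I$. *)

(* Defs.v *)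
From HB Require Import structures.
From mathcomp Require Import all_boot all_order all_algebra.
From mathcomp Require Import mpoly.

Set Implicit Arguments.
Unset Strict Implicit.
Unset Printing Implicit Defensive.

Import GRing.Theory.
Local Open Scope ring_scope.

(* Ideals of a commutative ring are predicates in Prop, since membership is
   not decidable over an arbitrary coefficient ring. *)
Section Ideals.
Variable R : comNzRingType.
Implicit Types (G I : R -> Prop) (p : R).

Definition ideal_gen G p : Prop :=
  exists2 s : seq (R * R),
    (forall t, t \in s -> G t.2) & p = \sum_(t <- s) t.1 * t.2.

Definition ideal_pow I (k : nat) : R -> Prop :=
  ideal_gen (fun q => exists2 a : 'I_k -> R,
    (forall t, I (a t)) & q = \prod_(t < k) a t).

Definition ideal_sum (r : nat) (I_ : 'I_r -> R -> Prop) p : Prop :=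
  exists2 q : 'I_r -> R, (forall i, I_ i (q i)) & p = \sum_(i < r) q i.

End Ideals.

Definition ideal_Sq (A : comNzRingType) (N : nat) (I : {mpoly A[N]} -> Prop) :
    {mpoly A[N]} -> Prop :=
  ideal_gen (fun q => exists2 m : 'X_{1..N}, I 'X_[m] & q = 'X_[m] ^+ 2).

(* Variables are indexed from 0, so the variable of index l has degree l.+1. *)
Definition wdeg (k : nat) (a : 'X_{1..k}) : nat := (\sum_(l < k) l.+1 * a l)%N.

Definition wgrevlex_lt (k : nat) (a b : 'X_{1..k}) : bool :=
  (wdeg a < wdeg b)%N
  || (wdeg a == wdeg b)
     && [exists l : 'I_k, (b l < a l)%N
         && [forall k' : 'I_k, (l < k')%N ==> (a k' == b k')]].

Section PFiso.
Variables (A : comNzRingType) (r : nat) (n_ : 'I_r -> nat).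

Local Notation N := (\sum_(i < r) n_ i)%N.
Local Notation S := {mpoly A[N]}.

(* [tagnat.Rank] is the bijection from pairs (i, j), with i : 'I_r and
   j : 'I_(n_ i), to 'I_N; cvar i j is the variable c_{i+1,j+1}. *)
Definition cvar (i : 'I_r) (j : 'I_(n_ i)) : S := 'X_(tagnat.Rank i j).

Definition mblock (i : 'I_r) (m : 'X_{1..N}) : 'X_{1..n_ i} :=
  [multinom m (tagnat.Rank i j) | j < n_ i].

Definition block_lt (m1 m2 : 'X_{1..N}) : bool :=
  [exists i : 'I_r,
     wgrevlex_lt (mblock i m1) (mblock i m2)
     && [forall k : 'I_r, (k < i)%N ==> (mblock k m1 == mblock k m2)]].

Definition is_lead_mon (p : S) (m : 'X_{1..N}) : Prop :=
  m \in msupp p /\ forall m', m' \in msupp p -> m' != m -> block_lt m' m.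

Definition lead_ideal (I : S -> Prop) : S -> Prop :=
  ideal_gen (fun q => exists p m,
    [/\ I p, p != 0, is_lead_mon p m & q = p@_m *: 'X_[m]]).

Definition gfactor (i : 'I_r) : {poly S} :=
  'X^(n_ i) + \sum_(j < n_ i) cvar j *: 'X^(n_ i - j.+1).

(* For monic g of degree m this is (-1)^m g(-x). *)
Definition pstar (R : comNzRingType) (g : {poly R}) : {poly R} :=
  (-1) ^+ (size g).-1 *: (g \Po (- 'X)).

Definition PFiso_divisor : {poly S} :=
  (\prod_(i < r) gfactor i) * \prod_(i < r) pstar (gfactor i).

(* The divisor is monic, so [Pdiv.Ring.rmodp] is the usual remainder over the
   ring S, which need not be a domain. *)
Definition PFiso_ideal (f : {poly A}) : S -> Prop :=
  ideal_gen (fun q => exists k : nat,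
    q = (Pdiv.Ring.rmodp (map_poly (@mpolyC N A) f) PFiso_divisor)`_k).

Definition block_ideal (i : 'I_r) : S -> Prop :=
  ideal_gen (fun q => exists j : 'I_(n_ i), q = cvar j).

End PFiso.

Arguments block_ideal A {r} n_ i _.
Arguments PFiso_ideal {A r} n_ f _.
Arguments lead_ideal {A r} n_ I _.

(* Main.v *)
(** Write f = F(x^2) with F monic of degree n.  Since g g^* = h(x^2) where h has
    coefficients +-c_k^2 + (smaller terms of the same weight), J is generated by
    the coefficients of the remainder of F by h_1 ... h_r.

    Right-hand side inside l(J).  Modulo J one has F = V Q, where
    V = h_i ... h_r and Q is monic of degree d = n - n_i - ... - n_r.  For every
    nonincreasing sequence mu_0, ..., mu_d in {1, ..., n_i}, choosing d + 1 of
    these coefficient equations gives a square matrix killing the coefficient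
    vector of Q modulo J; as the leading coefficient of Q is 1, its determinant
    lies in J.  The determinant is a perturbed dual Jacobi-Trudi determinant and
    its leading monomial is the diagonal one, the product of the c_{i,mu_t}^2.

    Equality.  Division by these elements writes S/J as the span of the standard
    monomials, those outside the right-hand side.  Let B be the ring obtained
    from A by adjoining successive roots x_1, ..., x_n with
    f = (x^2 - x_1^2) ... (x^2 - x_n^2); it is free of rank 2^n n! over A.
    Sending g_i to the product of x - x_k over the i-th block of roots defines
    S/J -> B, and B is spanned over its image by
    n_1! ... n_r! 2^(n-N) (n-N)! elements, N = n_1 + ... + n_r.  Multiplying by
    the number of standard monomials gives exactly 2^n n!, and a spanning family
    of that size in a free module of that rank is free; hence the standard
    monomials are linearly independent modulo J. *)

Require Import Defs.
From HB Require Import structures.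
From mathcomp Require Import all_boot all_order all_algebra all_fingroup.
From mathcomp Require Import qpoly.
From mathcomp Require Import mpoly.
From mathcomp Require Import zify.
From Stdlib Require Import Wellfounded.

Set Implicit Arguments.
Unset Strict Implicit.
Unset Printing Implicit Defensive.

Import GRing.Theory.
Local Open Scope ring_scope.

(** * Spanning families and adjunction of roots *)

Section Division.
Import Pdiv.CommonRing Pdiv.RingMonic.

Lemma size_monic_map (C B : nzRingType) (psi : {rmorphism C -> B})
    (d : {poly C}) : d \is monic -> size (map_poly psi d) = size d.
Proof.
by move=> /monicP dm; rewrite size_map_poly_id0 // dm rmorph1 oner_eq0.
Qed.

(** A ring map sends the division identity to one whose divisor has the same size, and quotient and
    remainder by a monic divisor are unique. *)
Lemma map_rdivp_monic (C B : nzRingType) (psi : {rmorphism C -> B})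
    (u d : {poly C}) : d \is monic ->
  map_poly psi (rdivp u d) = rdivp (map_poly psi u) (map_poly psi d).
Proof.
move=> dm; rewrite {2}(rdivp_eq dm u) rmorphD rmorphM /=.
rewrite rdivp_addl_mul_small ?monic_map // (size_monic_map psi dm).
exact: leq_ltn_trans (size_poly _ _) (ltn_rmodpN0 _ (monic_neq0 dm)).
Qed.

Lemma map_rmodp_monic (C B : nzRingType) (psi : {rmorphism C -> B})
    (u d : {poly C}) : d \is monic ->
  map_poly psi (rmodp u d) = rmodp (map_poly psi u) (map_poly psi d).
Proof.
move=> dm; rewrite {2}(rdivp_eq dm u) rmorphD rmorphM /=.
rewrite rmodp_addl_mul_small ?monic_map // (size_monic_map psi dm).
exact: leq_ltn_trans (size_poly _ _) (ltn_rmodpN0 _ (monic_neq0 dm)).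
Qed.

Lemma rdivp_monic (C : nzRingType) (u d : {poly C}) :
  u \is monic -> d \is monic -> (size d <= size u)%N -> rdivp u d \is monic.
Proof.
move=> um dm dle; have := monicP um; rewrite {1}(rdivp_eq dm u) lead_coefDl.
  by rewrite lead_coef_Mmonic // => /monicP.
have rlt := ltn_rmodpN0 u (monic_neq0 dm).
suff : rdivp u d != 0.
  move=> q0; rewrite size_Mmonic // (leq_trans rlt) //.
  by rewrite -(size_poly_gt0 (rdivp u d)) in q0; lia.
apply/eqP => q0; have := rdivp_eq dm u; rewrite q0 mul0r add0r => ru.
by move: rlt; rewrite -ru ltnNge dle.
Qed.

Lemma size_rdivp_monic (C : nzRingType) (u d : {poly C}) :
  u \is monic -> d \is monic -> (size d <= size u)%N ->
  (size (rdivp u d) + (size d).-1)%N = size u.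
Proof.
move=> um dm dle; have qm := rdivp_monic um dm dle.
have rlt := ltn_rmodpN0 u (monic_neq0 dm).
have := size_poly_gt0 (rdivp u d); rewrite monic_neq0 // => q0.
have := size_poly_gt0 d; rewrite monic_neq0 // => d0.
have sM : size (rdivp u d * d) = (size (rdivp u d) + (size d).-1)%N.
  by rewrite size_Mmonic // ?monic_neq0 //; lia.
rewrite {2}(rdivp_eq dm u) size_polyDl // sM; lia.
Qed.

End Division.

Section Spans.
Import Pdiv.CommonRing Pdiv.RingMonic.

(** [B] is viewed as a module over [C] through [psi]; working with the bare map avoids fixing a
    module structure on [B]. *)
Definition spans (C B : pzRingType) (psi : C -> B) (I : finType) (e : I -> B)
  (b : B) := exists c : I -> C, b = \sum_i psi (c i) * e i.

(** Expand over [C'] first, then each coefficient over [C]: as in a tower of extensions, the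
    products of the two families span. *)
Lemma spans_tower (C C' B : pzRingType) (psi : {rmorphism C -> B})
    (psi' : C' -> B) (I I' : finType) (e : I -> B) (e' : I' -> B) :
  (forall c, spans psi e (psi' c)) -> forall b, spans psi' e' b ->
  spans psi (fun k : I * I' => e k.1 * e' k.2) b.
Proof.
move=> sp b [c' ->].
have /fin_all_exists [c cE] i' := sp (c' i').
exists (fun k => c k.2 k.1).
rewrite -(pair_bigA _ (fun i i' => psi (c i' i) * (e i * e' i'))) exchange_big.
apply: eq_bigr => i' _; rewrite cE mulr_suml.
by apply: eq_bigr => i _; rewrite mulrA.
Qed.

(** Replacing [q] by its remainder modulo [u] does not change the value at a root of [u], and the
    remainder has at most [m] coefficients. *)
Lemma spans_root (C B : comNzRingType) (psi : {rmorphism C -> B})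
    (u : {poly C}) (y : B) (m : nat) :
  u \is monic -> size u = m.+1 -> root (map_poly psi u) y ->
  forall q : {poly C},
  spans psi (fun i : 'I_m => y ^+ i) (map_poly psi q).[y].
Proof.
move=> um su /rootP uy q; exists (fun i : 'I_m => (rmodp q u)`_i).
rewrite {1}(rdivp_eq um q) rmorphD rmorphM /= hornerD hornerM uy mulr0 add0r.
have rlt : (size (rmodp q u) <= m)%N.
  by rewrite -ltnS -su ltn_rmodpN0 // monic_neq0.
rewrite (horner_coef_wide y (leq_trans (size_poly _ _) rlt)).
by apply: eq_bigr => i _; rewrite coef_map.
Qed.

Lemma size_prod_XnsubC (B : comNzRingType) (s : nat) (x : seq B) : (0 < s)%N ->
  size (\prod_(y <- x) ('X^s - (y ^+ s)%:P)) = (s * size x).+1 /\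
  \prod_(y <- x) ('X^s - (y ^+ s)%:P) \is monic.
Proof.
move=> s0; elim: x => [|y x [IHs IHm]] /=.
  by rewrite big_nil size_poly1 muln0 monic1.
have ym : 'X^s - (y ^+ s)%:P \is monic by rewrite monicXnsubC.
rewrite big_cons; split; last by rewrite rpredM.
by rewrite size_monicM ?monic_neq0 // IHs size_XnsubC // mulnS; lia.
Qed.

(** [C'] is an iterated polynomial ring mapped to [B]; no relations are imposed on it, since only
    spanning inside [B] is claimed. Each new root [y] is killed by a monic polynomial of degree [s]
    times the number of roots left, so that many powers of [y] suffice, and these degrees multiply
    to the count. *)
Lemma adjoin_roots (s : nat) (B : comNzRingType) (x : seq B) :
  (0 < s)%N -> forall (C : comNzRingType) (psi : {rmorphism C -> B})
    (u : {poly C}),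
  u \is monic -> map_poly psi u = \prod_(y <- x) ('X^s - (y ^+ s)%:P) ->
  exists (C' : comNzRingType) (psi' : {rmorphism C' -> B})
    (iota : {rmorphism C -> C'}) (I : finType) (e : I -> B),
  [/\ #|I| = (s ^ size x * (size x)`!)%N, forall c, psi' (iota c) = psi c,
      forall y, y \in x -> exists c, psi' c = y &
      forall c, spans psi e (psi' c)].
Proof.
move=> s0; elim: x => [|y x IH] C psi u um uE.
  exists C, psi, idfun, unit, (fun=> 1); split=> //.
    by rewrite card_unit expn0.
  by move=> c; exists (fun=> c); rewrite (big_pred1 tt) ?mulr1 //; case.
have [sx xm] := size_prod_XnsubC (y :: x) s0.
have [sx' xm'] := size_prod_XnsubC x s0.
have su : size u = (s * (size x).+1).+1 by rewrite -(size_monic_map psi um) uE.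
pose psi1 : {rmorphism {poly C} -> B} := horner_eval y \o map_poly psi.
have psi1E q : psi1 q = (map_poly psi q).[y] by [].
clearbody psi1.
have psi1C c : psi1 c%:P = psi c by rewrite psi1E map_polyC hornerC.
have psi1X : psi1 'X = y by rewrite psi1E map_polyX hornerX.
pose d : {poly {poly C}} := 'X^s - ('X^s)%:P.
have dm : d \is monic by rewrite monicXnsubC.
have dE : map_poly psi1 d = 'X^s - (y ^+ s)%:P.
  by rewrite rmorphB /= map_polyXn map_polyC /= rmorphXn psi1X.
have uE1 : map_poly psi1 (map_poly polyC u) = map_poly psi u.
  by rewrite -map_poly_comp; apply: eq_map_poly => c /=; rewrite psi1C.
(* Division by [d] over [{poly C}] may leave a remainder; it becomes exact after [psi1], which sends
   [d] to a factor of the image of [u]. *)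
have u1m : rdivp (map_poly polyC u) d \is monic.
  rewrite rdivp_monic ?monic_map // size_monic_map // su size_XnsubC //.
  by rewrite ltnS leq_pmulr.
have u1E : map_poly psi1 (rdivp (map_poly polyC u) d) =
    \prod_(z <- x) ('X^s - (z ^+ s)%:P).
  by rewrite map_rdivp_monic // uE1 uE dE big_cons mulrC rdivp_mull
    ?monicXnsubC.
have [C' [psi' [iota [I [e [cI iotaE xin sp]]]]]] := IH _ _ _ u1m u1E.
exists C', psi', (iota \o polyC), ('I_(s * (size x).+1) * I)%type,
  (fun k : 'I_(s * (size x).+1) * I => y ^+ k.1 * e k.2); split.
- by rewrite card_prod card_ord cI factS expnS mulnACA.
- by move=> c /=; rewrite iotaE psi1C.
- move=> z; rewrite inE => /predU1P[->|/xin //].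
  by exists (iota 'X); rewrite iotaE psi1X.
- move=> c.
  apply: (@spans_tower _ _ _ _ _ 'I_(s * (size x).+1) _ (fun i => y ^+ i))
    (sp c) => q; rewrite psi1E; apply: spans_root um su _ q.
  by apply/rootP; rewrite uE big_cons !hornerE subrr mul0r.
Qed.

End Spans.

(** * The splitting ring of an even polynomial *)

Section SplittingRing.
Import Pdiv.CommonRing Pdiv.RingMonic.

Lemma size_comp_X2 (A : comNzRingType) (p : {poly A}) (n : nat) :
  size p = n.+1 -> size (p \Po 'X^2) = n.*2.+1.
Proof.
move=> sp; have p0 : lead_coef p != 0.
  by rewrite lead_coef_eq0 -size_poly_gt0 sp.
apply/eqP; rewrite eqn_leq; apply/andP; split.
  have := size_comp_poly_leq p 'X^2.
  by rewrite sp size_polyXn /= muln2.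
rewrite leqNgt; apply/negP => slt.
move: p0; rewrite /lead_coef sp /=.
have := coef_comp_poly_Xn p n.*2 (isT : (0 < 2)%N).
rewrite -muln2 dvdn_mull // mulnK // => <-.
by rewrite nth_default ?eqxx // muln2.
Qed.

Lemma monic_comp_X2 (A : comNzRingType) (p : {poly A}) :
  p \is monic -> p \Po 'X^2 \is monic.
Proof.
move=> pm; apply/monicP; rewrite /lead_coef.
have sp : size p = (size p).-1.+1.
  by have := monic_neq0 pm; rewrite -size_poly_gt0; lia.
rewrite (size_comp_X2 sp) /= coef_comp_poly_Xn // -muln2 dvdn_mull // mulnK //.
exact/monicP.
Qed.

(** Adjoin a root xi of F(x^2) by a quotient ring, free on 2 deg F powers of xi, split X - xi^2 off
    F and repeat; the ranks multiply to 2^n n!. The last clause says, as an induction principle,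
    that the image of [phi] and the roots generate [B] as a ring. *)
Lemma splitting_ring (n : nat) : forall (A : comNzRingType) (F : {poly A}),
  F \is monic -> size F = n.+1 ->
  exists (B : comNzRingType) (phi : {rmorphism A -> B}) (x : seq B)
    (I : finType) (e : I -> B),
  [/\ size x = n /\ map_poly phi F = \prod_(y <- x) ('X - (y ^+ 2)%:P),
      #|I| = (2 ^ n * n`!)%N,
      forall b, spans phi e b,
      forall c : I -> A, \sum_i phi (c i) * e i = 0 -> forall i, c i = 0 &
      forall P : B -> Prop, (forall a b, P a -> P b -> P (a + b)) ->
        (forall a b, P a -> P b -> P (a * b)) -> (forall a, P (phi a)) ->
        (forall y, y \in x -> P y) -> forall b, P b].
Proof.
elim: n => [|n IH] A F Fm sF.
  exists A, idfun, [::], unit, (fun=> 1); split=> //.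
  - split=> //; rewrite big_nil map_poly_id //.
    have := size1_polyC (eq_leq sF) => FE; move/monicP: Fm.
    by rewrite FE lead_coefC => ->.
  - by rewrite card_unit.
  - by move=> c; exists (fun=> c); rewrite (big_pred1 tt) ?mulr1 //; case.
  - by move=> c; rewrite (big_pred1 tt) /= ?mulr1; [move=> cE [] | case].
pose f := F \Po 'X^2.
have fm : f \is monic by exact: monic_comp_X2.
have sf : size f = n.+1.*2.+1 by exact: size_comp_X2.
(* [{poly %/ f}] is the quotient by [mk_monic f], which is [f] itself because [f] is monic of
   positive degree. *)
have mkf : mk_monic f = f by rewrite /mk_monic sf fm.
pose A1 : comNzRingType := {poly %/ f}.
pose inq : {rmorphism {poly A} -> A1} := in_qpoly f.
pose phi0 : {rmorphism A -> A1} := inq \o polyC.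
pose xi : A1 := inq 'X.
have phi0E a : phi0 a = inq a%:P by [].
have inqE q : (val (inq q : {poly %/ f}) : {poly A}) = rmodp q f by rewrite /= mkf.
have evE p q : (map_poly phi0 q).[inq p] = inq (q \Po p).
  by rewrite /comp_poly -horner_map -map_poly_comp.
have inqX q : inq q = \sum_(i < n.+1.*2) phi0 (rmodp q f)`_i * xi ^+ i.
  have -> : inq q = inq (rmodp q f).
    by apply: val_inj; rewrite !inqE rmodp_id.
  have rlt : (size (rmodp q f) <= n.+1.*2)%N.
    by rewrite -ltnS -sf ltn_rmodpN0 // monic_neq0.
  rewrite -{1}(comp_polyXr (rmodp q f)) -evE.
  rewrite (horner_coef_wide _ (leq_trans (size_poly _ _) rlt)).
  by apply: eq_bigr => i _; rewrite coef_map.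
have inq_surj (b : A1) : exists q, b = inq q.
  exists (val (b : {poly %/ f})); apply: val_inj; rewrite inqE rmodp_small //.
  have smk : size (mk_monic f) = size f by rewrite mkf.
  by rewrite -smk; exact: size_mk_monic.
have xi_free (c : 'I_n.+1.*2 -> A) :
    \sum_i phi0 (c i) * xi ^+ i = 0 -> forall i, c i = 0.
  have -> : \sum_i phi0 (c i) * xi ^+ i = inq (\sum_i c i *: 'X^i).
    rewrite rmorph_sum; apply: eq_bigr => i _.
    by rewrite -mul_polyC rmorphM rmorphXn.
  move=> /(congr1 (fun z : A1 => val (z : {poly %/ f}))).
  have sP : (size (\sum_(i < n.+1.*2) c i *: 'X^i)%R < size f)%N.
    rewrite sf ltnS; apply: (leq_trans (size_sum _ _ _)).
    apply/bigmax_leqP => i _; apply: leq_trans (size_scale_leq _ _) _.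
    by rewrite size_polyXn.
  rewrite inqE rmodp_small //= => /polyP c0 i.
  have := c0 i; rewrite coef0 coef_sum (bigD1 i) //= coefZ coefXn eqxx mulr1.
  rewrite big1 ?addr0 // => j ji.
  by rewrite coefZ coefXn eq_sym val_eqE (negPf ji) mulr0.
have inqf : inq f = 0 by apply: val_inj; rewrite inqE rmodpp.
clearbody inq.
pose d : {poly A1} := 'X - (xi ^+ 2)%:P.
have dm : d \is monic by rewrite monicXsubC.
have Fm0 : map_poly phi0 F \is monic by rewrite monic_map.
have sF0 : size (map_poly phi0 F) = n.+2 by rewrite size_monic_map.
(* xi^2 is a root of F, as F(xi^2) is the class of [f], so this division is exact. *)
have dF : rdivp (map_poly phi0 F) d * d = map_poly phi0 F.
  apply: rdivpK => //; apply/Pdiv.Ring.polyXsubCP.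
  by rewrite -rmorphXn evE inqf.
have F1m : rdivp (map_poly phi0 F) d \is monic.
  by rewrite rdivp_monic // size_XsubC sF0.
have sF1 : size (rdivp (map_poly phi0 F) d) = n.+1.
  have := size_rdivp_monic Fm0 dm; rewrite size_XsubC sF0 => /(_ isT); lia.
have [B [phi1 [x [I [e [[sx F1E] cI sp fr gen]]]]]] := IH _ _ F1m sF1.
exists B, (phi1 \o phi0), (phi1 xi :: x), ('I_n.+1.*2 * I)%type,
  (fun k : 'I_n.+1.*2 * I => phi1 (xi ^+ k.1) * e k.2); split.
- rewrite /= sx; split=> //.
  rewrite map_poly_comp -dF rmorphM /= F1E big_cons mulrC; congr (_ * _).
  by rewrite rmorphB /= map_polyX map_polyC /= rmorphXn.
- rewrite card_prod card_ord cI factS expnS -!mul2n; lia.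
- move=> b; apply: (@spans_tower _ _ _ _ _ 'I_n.+1.*2 _
    (fun i => phi1 (xi ^+ i))) (sp b) => a1.
  have [q ->] := inq_surj a1; rewrite inqX rmorph_sum.
  exists (fun i : 'I_n.+1.*2 => (rmodp q f)`_i).
  by apply: eq_bigr => i _; rewrite rmorphM.
- move=> c c0 [i j]; apply: (xi_free (fun i => c (i, j))); move: j {i}.
  apply: fr; rewrite -[RHS]c0.
  rewrite (eq_bigr (fun k : 'I_n.+1.*2 * I =>
    phi1 (phi0 (c (k.1, k.2))) * (phi1 (xi ^+ k.1) * e k.2))); last by case.
  rewrite -(pair_bigA _
    (fun i j => phi1 (phi0 (c (i, j))) * (phi1 (xi ^+ i) * e j))).
  rewrite exchange_big; apply: eq_bigr => j _.
  rewrite rmorph_sum mulr_suml; apply: eq_bigr => i _.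
  by rewrite rmorphM mulrA.
- move=> P PD PM Pphi Px b.
  have Pxi : P (phi1 xi) by apply: Px; rewrite mem_head.
  apply: gen => // [a1|y yx]; last by apply: Px; rewrite inE yx orbT.
  have [q ->] := inq_surj a1; rewrite inqX rmorph_sum.
  apply: (big_ind P); first by rewrite -(rmorph0 (phi1 \o phi0)); exact: Pphi.
    exact: PD.
  move=> i _; rewrite rmorphM rmorphXn; apply: (PM); first exact: Pphi.
  elim: (nat_of_ord i) => [|k IHk]; last by rewrite exprS; exact: PM.
  by rewrite expr0 -(rmorph1 (phi1 \o phi0)); exact: Pphi.
Qed.
End SplittingRing.

(** * The monomial order *)

Section Wgrevlex.
Variable k : nat.
Implicit Types a b c : 'X_{1..k}.

Lemma wdegD a b : wdeg (a + b)%MM = (wdeg a + wdeg b)%N.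
Proof.
rewrite /wdeg -big_split; apply: eq_bigr => l _.
by rewrite mnmDE mulnDr.
Qed.

Lemma wdeg0 : wdeg (0%MM : 'X_{1..k}) = 0%N.
Proof. by rewrite /wdeg big1 // => l _; rewrite mnm0E muln0. Qed.

Lemma wdeg_sum (T : finType) (P : pred T) (F : T -> 'X_{1..k}) :
  wdeg (\sum_(t | P t) F t)%MM = (\sum_(t | P t) wdeg (F t))%N.
Proof. by rewrite (big_morph _ wdegD wdeg0). Qed.

Lemma wgrevlexP a b : reflect
  ((wdeg a < wdeg b)%N \/ wdeg a = wdeg b /\
    exists2 l : 'I_k, (b l < a l)%N & forall l' : 'I_k, (l < l')%N -> a l' = b l')
  (wgrevlex_lt a b).
Proof.
apply: (iffP orP) => [[->|/andP[/eqP ab /existsP[l /andP[bal /forallP eqa]]]]|].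
- by left.
- right; split=> //; exists l => // l' ll'.
  by have := eqa l'; rewrite ll' => /eqP.
case=> [|[ab [l bal eqa]]]; [by left | right].
rewrite ab eqxx; apply/existsP; exists l; rewrite bal; apply/forallP => l'.
by apply/implyP => /eqa ->.
Qed.

Lemma wgrevlex_irr a : wgrevlex_lt a a = false.
Proof. by apply/negP => /wgrevlexP[|[_ [l]]]; rewrite ltnn. Qed.

Lemma wgrevlex_trans b a c :
  wgrevlex_lt a b -> wgrevlex_lt b c -> wgrevlex_lt a c.
Proof.
move=> /wgrevlexP ab /wgrevlexP bc; apply/wgrevlexP.
case: ab => [ab|[ab [l abl eqab]]].
  by case: bc => [bc|[bc _]]; left; lia.
case: bc => [bc|[bc [l' bcl eqbc]]]; first by left; lia.
right; split; first by rewrite ab.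
case: (ltngtP l l') => [ll'|ll'|/val_inj ll'].
- exists l'; first by rewrite eqab.
  by move=> j lj; rewrite eqab ?eqbc // (ltn_trans ll').
- exists l; first by rewrite -eqbc.
  by move=> j lj; rewrite eqab ?eqbc // (ltn_trans ll').
- exists l; first by move: bcl; rewrite -ll'; lia.
  by move=> j lj; rewrite eqab ?eqbc // -ll'.
Qed.

Lemma wgrevlexD2r c a b : wgrevlex_lt a b -> wgrevlex_lt (a + c)%MM (b + c)%MM.
Proof.
move=> /wgrevlexP ab; apply/wgrevlexP; rewrite !wdegD.
case: ab => [ab|[-> [l ba eqab]]]; [left; lia | right; split=> //].
by exists l => [|l' /eqab eql]; rewrite !mnmDE ?eql //; lia.
Qed.

Lemma mdeg_le_wdeg a : (mdeg a <= wdeg a)%N.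
Proof. by rewrite mdegE /wdeg; apply: leq_sum => l _; rewrite leq_pmull. Qed.

(** The position of [a] in the order, an embedding into the natural numbers. The count is finite
    because smaller exponent vectors have weight, hence degree, at most [wdeg a]. *)
Definition wrank a : nat :=
  #|[set b : 'X_{1..k < (wdeg a).+1} | wgrevlex_lt b a]|.

Lemma wrank_lt a b : wgrevlex_lt a b -> (wrank a < wrank b)%N.
Proof.
move=> ab; have le_ab : (wdeg a <= wdeg b)%N.
  by case/wgrevlexP: ab => [/ltnW|[->]].
have bound c : wgrevlex_lt c b -> (mdeg c < (wdeg b).+1)%N.
  move=> cb; rewrite ltnS (leq_trans (mdeg_le_wdeg c)) //.
  by case/wgrevlexP: cb => [/ltnW|[->]].
pose h (c : 'X_{1..k < (wdeg a).+1}) : 'X_{1..k < (wdeg b).+1} :=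
  BMultinom (leq_trans (bmdeg c) (le_ab : (wdeg a).+1 <= (wdeg b).+1)%N).
have hinj : injective h.
  by move=> c d cd; apply/val_inj; have := congr1 (fun z => val z) cd.
rewrite /wrank -(card_imset _ hinj); apply: proper_card.
apply/properP; split.
  apply/subsetP => _ /imsetP[c + ->]; rewrite !inE => ca.
  exact: wgrevlex_trans ca ab.
exists (BMultinom (bound a ab)); rewrite ?inE //.
apply/negP => /imsetP[c]; rewrite inE => ca cE.
by move: ca; rewrite -[X in wgrevlex_lt X](congr1 val cE) /= wgrevlex_irr.
Qed.

End Wgrevlex.

Section BlockOrder.
Variables (r : nat) (n_ : 'I_r -> nat).
Local Notation N := (\sum_(i < r) n_ i)%N.
Implicit Types m : 'X_{1..N}.

Lemma mblockD i m1 m2 :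
  mblock i (m1 + m2)%MM = (mblock i m1 + mblock i m2)%MM.
Proof. by apply/mnmP => j; rewrite !(mnmE, mnmDE). Qed.

Lemma mblock0 i : mblock i (0%MM : 'X_{1..N}) = 0%MM.
Proof. by apply/mnmP => j; rewrite !(mnmE, mnm0E). Qed.

Lemma mblock_sum i (T : finType) (P : pred T) (F : T -> 'X_{1..N}) :
  mblock i (\sum_(t | P t) F t)%MM = (\sum_(t | P t) mblock i (F t))%MM.
Proof. by rewrite (big_morph _ (mblockD i) (mblock0 i)). Qed.

Lemma mblock_inj m1 m2 : (forall i, mblock i m1 = mblock i m2) -> m1 = m2.
Proof.
move=> eqm; apply/mnmP => k; rewrite -(tagnat.sig2K k).
by have /mnmP/(_ (tagnat.sig2 k)) := eqm (tagnat.sig1 k); rewrite !mnmE.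
Qed.

Lemma block_ltP m1 m2 : reflect
  (exists2 i : 'I_r, wgrevlex_lt (mblock i m1) (mblock i m2) &
    forall k : 'I_r, (k < i)%N -> mblock k m1 = mblock k m2)
  (block_lt m1 m2).
Proof.
apply: (iffP existsP) => [[i /andP[lti /forallP eqi]]|[i lti eqi]]; exists i => //.
  by move=> k ki; have := eqi k; rewrite ki => /eqP.
by rewrite lti; apply/forallP => k; apply/implyP => /eqi ->.
Qed.

Lemma block_lt_irr m : block_lt m m = false.
Proof. by case: block_ltP => // -[i]; rewrite wgrevlex_irr. Qed.

Lemma block_lt_trans m2 m1 m3 :
  block_lt m1 m2 -> block_lt m2 m3 -> block_lt m1 m3.
Proof.
move=> /block_ltP[i lti eqi] /block_ltP[j ltj eqj]; apply/block_ltP.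
case: (ltngtP i j) => [ij|ij|/val_inj ij].
- exists i; first by rewrite -(eqj _ ij).
  by move=> k ki; rewrite eqi // eqj // (ltn_trans ki).
- exists j; first by rewrite (eqi _ ij).
  by move=> k ki; rewrite eqi ?eqj // (ltn_trans ki).
- exists i; last by move=> k ki; rewrite eqi ?eqj // -ij.
  by apply: wgrevlex_trans lti _; rewrite ij.
Qed.

Lemma block_ltD2r m m1 m2 :
  block_lt m1 m2 -> block_lt (m1 + m)%MM (m2 + m)%MM.
Proof.
move=> /block_ltP[i lti eqi]; apply/block_ltP; exists i.
  by rewrite !mblockD wgrevlexD2r.
by move=> k /eqi eqk; rewrite !mblockD eqk.
Qed.

(** Descending induction on j: x is accessible once all smaller elements first differing from it at
    a coordinate below j are. For j = r this is the definition of accessibility; for j = 0 there is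
    nothing left to assume. Lowering j by one uses induction on the value of the new coordinate. *)
Lemma lex_wf (T : Type) (v : 'I_r -> T -> nat) :
  well_founded (fun x y => exists2 i, (v i x < v i y)%N &
    forall k : 'I_r, (k < i)%N -> v k x = v k y).
Proof.
pose lt x y := exists2 i, (v i x < v i y)%N &
  forall k : 'I_r, (k < i)%N -> v k x = v k y.
rewrite -/lt.
suff H j : (j <= r)%N -> forall x, (forall y, (exists2 i : 'I_r,
    (i < j)%N /\ (v i y < v i x)%N &
    forall k : 'I_r, (k < i)%N -> v k y = v k x) -> Acc lt y) -> Acc lt x.
  by move=> x; apply: (H 0%N (leq0n r)) => y [i []]; rewrite ltn0.
move=> jr; rewrite -(subKn jr); elim: (r - j)%N => [|d IH] x accx.
  rewrite subn0 in accx; apply: Acc_intro => y [i lti eqi].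
  by apply: accx; exists i.
have [rd|dr] := leqP r d.
  apply: IH => y [i [ir] _]; move: ir; rewrite (eqP rd) //.
have lt_r : (r - d.+1 < r)%N by lia.
pose i0 := Ordinal lt_r.
have [b] := ubnP (v i0 x); elim: b x accx => [|b IHb] x accx vx.
  by rewrite ltn0 in vx.
apply: IH => y [i [id ltvi] eqi].
have [ii|ii] := ltnP i (r - d.+1).
  by apply: accx; exists i.
have ii0 : i = i0 by apply: val_inj => /=; lia.
rewrite {}ii0 in ltvi eqi; apply: IHb; last by lia.
move=> z [i' [lti' ltvz] eqi']; apply: accx; exists i'; first split=> //.
  by rewrite -(eqi i').
by move=> k ki'; rewrite eqi' // eqi //= (ltn_trans ki').
Qed.

Lemma block_lt_wf : well_founded (@block_lt r n_).
Proof.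
apply: wf_incl (lex_wf (fun i m => wrank (mblock i m))) => m1 m2.
move=> /block_ltP[i lti eqi]; exists i; first exact: wrank_lt.
by move=> k /eqi ->.
Qed.

End BlockOrder.

(** * Ideals and leading monomials *)

Section IdealGen.
Variables (R : comNzRingType) (G : R -> Prop).

Lemma ideal_gen0 : ideal_gen G 0.
Proof. by exists [::] => //; rewrite big_nil. Qed.

Lemma ideal_gen_mem p : G p -> ideal_gen G p.
Proof.
move=> Gp; exists [:: (1, p)]; last by rewrite big_seq1 mul1r.
by move=> t; rewrite inE => /eqP ->.
Qed.

Lemma ideal_genD p q : ideal_gen G p -> ideal_gen G q -> ideal_gen G (p + q).
Proof.
move=> [s sG ->] [s' sG' ->]; exists (s ++ s'); last by rewrite big_cat.
by move=> t; rewrite mem_cat => /orP[/sG|/sG'].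
Qed.

Lemma ideal_genM p q : ideal_gen G q -> ideal_gen G (p * q).
Proof.
move=> [s sG ->]; exists [seq (p * t.1, t.2) | t <- s].
  by move=> t /mapP[t' /sG t'G ->].
by rewrite big_map mulr_sumr; apply: eq_bigr => t _; rewrite mulrA.
Qed.

Lemma ideal_genN p : ideal_gen G p -> ideal_gen G (- p).
Proof. by rewrite -mulN1r; exact: ideal_genM. Qed.

Lemma ideal_gen_sum (T : eqType) (s : seq T) (P : pred T) (F : T -> R) :
  (forall t, t \in s -> P t -> ideal_gen G (F t)) ->
  ideal_gen G (\sum_(t <- s | P t) F t).
Proof.
move=> GF; rewrite big_seq_cond; elim/big_ind: _ => [||t /andP[]].
- exact: ideal_gen0.
- exact: ideal_genD.
- exact: GF.
Qed.

Lemma ideal_gen_sub (G' : R -> Prop) :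
  (forall q, G q -> ideal_gen G' q) -> forall p, ideal_gen G p -> ideal_gen G' p.
Proof.
move=> GG' p [s sG ->]; rewrite big_seq; elim/big_ind: _ => [|p1 p2|t ts].
- by exists [::] => //; rewrite big_nil.
- move=> [s1 sG1 ->] [s2 sG2 ->]; exists (s1 ++ s2); last by rewrite big_cat.
  by move=> t; rewrite mem_cat => /orP[/sG1|/sG2].
- have [s' sG' tE] := GG' _ (sG _ ts); exists [seq (t.1 * u.1, u.2) | u <- s'].
    by move=> u /mapP[u' /sG' u'G ->].
  by rewrite big_map tE mulr_sumr; apply: eq_bigr => u _; rewrite mulrA.
Qed.

End IdealGen.

Section Leading.
Variables (A : comNzRingType) (r : nat) (n_ : 'I_r -> nat).
Local Notation N := (\sum_(i < r) n_ i)%N.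
Implicit Types (m : 'X_{1..N}) (p q : {mpoly A[N]}).

Lemma msupp_prod (T : eqType) (s : seq T) (p : T -> {mpoly A[N]}) m :
  uniq s -> m \in msupp (\prod_(t <- s) p t) ->
  exists2 f : T -> 'X_{1..N}, forall t, t \in s -> f t \in msupp (p t) &
    m = (\sum_(t <- s) f t)%MM.
Proof.
elim: s m => [|t s IH] m /=.
  rewrite big_nil msuppC oner_eq0 inE => _ /eqP ->.
  by exists (fun=> 0%MM) => //; rewrite big_nil.
rewrite big_cons => /andP[ts us] /msuppM_le/allpairsP[[m1 m2] /= [m1p m2p ->]].
have [f fp ->] := IH m2 us m2p.
exists (fun u => if u == t then m1 else f u).
  by move=> u; rewrite inE; case: eqP => [-> //|_ /= /fp].
rewrite big_cons eqxx; congr (_ + _)%MM.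
apply: eq_big_seq => u us'; case: eqP us' => // ->; by rewrite (negPf ts).
Qed.

(** [m] is only an upper bound of the support: with zero divisors in [A] the coefficient of a
    product at the product monomial may vanish, and the bound is still multiplicative. *)
Definition lead_le p m :=
  forall m', m' \in msupp p -> m' = m \/ block_lt m' m.

Lemma lead_leM p q m1 m2 : lead_le p m1 -> lead_le q m2 ->
  lead_le (p * q) (m1 + m2)%MM /\
  (p * q)@_(m1 + m2)%MM = p@_m1 * q@_m2.
Proof.
have ltD a1 b1 a2 b2 : block_lt a1 b1 -> a2 = b2 \/ block_lt a2 b2 ->
    block_lt (a1 + a2)%MM (b1 + b2 : 'X_{1..N})%MM.
  move=> lt1 [->|lt2]; first exact: block_ltD2r.
  apply: block_lt_trans (block_ltD2r a2 lt1) _.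
  by rewrite ![(b1 + _)%MM]addmC block_ltD2r.
move=> lp lq; split.
  move=> _ /msuppM_le/allpairsP[[a1 a2] /= [/lp l1 /lq l2 ->]].
  case: l1 => [->|l1]; last by right; apply: ltD.
  case: l2 => [->|l2]; first by left.
  by right; rewrite ![(m1 + _)%MM]addmC block_ltD2r.
(* Split off the term at [m1]: all monomials of [p'] are strictly below [m1], so [p' * q] does not
   reach the product monomial. *)
pose p' := p - p@_m1 *: 'X_[m1].
have pE : p = p@_m1 *: 'X_[m1] + p' by rewrite addrC subrK.
rewrite {1}pE mulrDl mcoeffD -scalerAl mcoeffZ ['X_[m1] * q]mulrC.
rewrite mcoeffMX [X in _ + X]memN_msupp_eq0 ?addr0 //.
apply/negP => /msuppM_le/allpairsP[[a1 a2] /= [a1p /lq l2]].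
have l1 : block_lt a1 m1.
  have [a1m1|a1m1] := eqVneq a1 m1.
    move: a1p; rewrite a1m1 mcoeff_msupp mcoeffB mcoeffZ mcoeffX eqxx mulr1.
    by rewrite subrr eqxx.
  case: (lp a1) => // [|a1E]; last by rewrite a1E eqxx in a1m1.
  move: a1p; rewrite !mcoeff_msupp mcoeffB mcoeffZ mcoeffX eq_sym.
  by rewrite eq_sym [m1 == _]eq_sym (negPf a1m1) mulr0 subr0.
by move=> E; have := ltD _ _ _ _ l1 l2; rewrite -E block_lt_irr.
Qed.

Lemma lead_le_prod (T : finType) (p : T -> {mpoly A[N]}) (m : T -> 'X_{1..N}) :
  (forall t, lead_le (p t) (m t)) ->
  (\prod_t p t)@_(\sum_t m t)%MM = \prod_t (p t)@_(m t).
Proof.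
move=> lp; suff [] : lead_le (\prod_t p t) (\sum_t m t)%MM /\
    (\prod_t p t)@_(\sum_t m t)%MM = \prod_t (p t)@_(m t) by [].
apply: (big_ind3 (fun q m c => lead_le q m /\ q@_m = c)) => //.
  rewrite mcoeff1 eqxx; split=> // m'.
  by rewrite msuppC oner_eq0 inE => /eqP ->; left.
move=> p1 m1 c1 p2 m2 c2 [l1 <-] [l2 <-]; exact: lead_leM.
Qed.

End Leading.

(** * The product of a polynomial with its reflection, as a polynomial in x^2 *)

Section EvenPart.
Variable R : comNzRingType.

(* Its roots are the squares of the roots of [g]. *)
Definition sqroots (g : {poly R}) : {poly R} :=
  (-1) ^+ (size g).-1 *: (even_poly g ^+ 2 - 'X * odd_poly g ^+ 2).

(** For g = e(x^2) + x o(x^2) the reflection is, up to sign, e(x^2) - x o(x^2), and the product is a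
    difference of squares. *)
Lemma mul_pstar (g : {poly R}) : g * pstar g = sqroots g \Po 'X^2.
Proof.
rewrite /pstar /sqroots; have := poly_even_odd g.
set e := even_poly g; set o := odd_poly g => gE.
have -> : g \Po - 'X = e \Po 'X^2 - (o \Po 'X^2) * 'X.
  rewrite -{1}gE comp_polyD comp_polyM -!comp_polyA comp_polyX.
  by rewrite comp_Xn_poly sqrrN mulrN.
rewrite -{1}gE -scalerAr -[RHS]/(comp_poly _ _) linearZ /= comp_polyB.
rewrite [comp_poly _ ('X * _)]comp_polyM comp_polyX ![comp_poly _ (_ ^+ 2)]rmorphXn /=.
by rewrite [_ * (_ - _)]mulrC -subr_sqr exprMn ['X^2 * _]mulrC.
Qed.

Lemma coef_pstar (g : {poly R}) (k : nat) :
  (pstar g)`_k = (-1) ^+ ((size g).-1 + k) * g`_k.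
Proof.
rewrite coefZ exprD -mulrA; congr (_ * _).
have -> : g \Po - 'X = \poly_(i < size g) ((-1) ^+ i * g`_i).
  rewrite comp_polyE poly_def; apply: eq_bigr => i _.
  by rewrite [(- 'X) ^+ i]exprNn -scalerA -!mul_polyC polyC_exp polyCN polyC1 mulrCA.
by rewrite coef_poly; case: ltnP => // sk; rewrite [g`_k]nth_default ?mulr0.
Qed.

Lemma coef_sqroots (g : {poly R}) (k : nat) :
  (sqroots g)`_k = (g * pstar g)`_(k.*2).
Proof.
by rewrite mul_pstar coef_comp_poly_Xn // -muln2 dvdn_mull // mulnK.
Qed.

Lemma size_pstar (g : {poly R}) : size (pstar g) = size g.
Proof.
apply/eqP; rewrite eqn_leq; apply/andP; split; apply/leq_sizeP => k sk.
  by rewrite coef_pstar nth_default ?mulr0.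
have := coef_pstar g k; rewrite [(pstar g)`_k]nth_default //.
by move/(congr1 (GRing.mul ((-1) ^+ ((size g).-1 + k))));
  rewrite mulr0 signrMK.
Qed.

Lemma monic_pstar (g : {poly R}) : g \is monic -> pstar g \is monic.
Proof.
move=> gm; apply/monicP; rewrite /lead_coef size_pstar coef_pstar.
by rewrite -signr_odd addnn odd_double mul1r; exact/monicP.
Qed.

Lemma size_sqroots (g : {poly R}) : g \is monic ->
  size (sqroots g) = size g /\ sqroots g \is monic.
Proof.
move=> gm; have pm := monic_pstar gm.
have sg : size g = (size g).-1.+1.
  by have := monic_neq0 gm; rewrite -size_poly_gt0; lia.
have sM : size (g * pstar g) = ((size g).-1.*2).+1.
  by rewrite size_Mmonic ?monic_neq0 // size_pstar; lia.
have lc : (sqroots g)`_(size g).-1 = 1.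
  have : g * pstar g \is monic by rewrite rpredM.
  by move/monicP; rewrite /lead_coef sM coef_sqroots.
have sS : size (sqroots g) = size g.
  apply/eqP; rewrite eqn_leq; apply/andP; split.
    apply/leq_sizeP => k sk; rewrite coef_sqroots nth_default // sM.
    by move: sk; rewrite sg; lia.
  rewrite sg; apply: contraT; rewrite -leqNgt => sk.
  by move: lc; rewrite nth_default // => /eqP; rewrite eq_sym oner_eq0.
by split=> //; apply/monicP; rewrite /lead_coef sS.
Qed.

End EvenPart.

(** * The factors g_i and h_i and their coefficients *)

Section Factors.
Variables (A : comNzRingType) (r : nat) (n_ : 'I_r -> nat).
Local Notation N := (\sum_(i < r) n_ i)%N.
Local Notation S := {mpoly A[N]}.
Implicit Types (i : 'I_r) (m : 'X_{1..N}) (p q : S).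

(* The exponent vector of c_{i,a}; it is 0 for a = 0 (c_{i,0} = 1) and also, as
   a junk value, for a > n_i. *)
Definition cmon i (a : nat) : 'X_{1..N} :=
  [multinom nat_of_bool ((tagnat.sig1 k == i) && ((tagnat.sig2 k).+1 == a))
    | k < N].

Lemma val_sig2_Rank i (j : 'I_(n_ i)) : tagnat.sig2 (tagnat.Rank i j) = j :> nat.
Proof. by rewrite tagnat.Rank2K. Qed.

Lemma mblock_cmon i a :
  mblock i (cmon i a) = [multinom nat_of_bool (j.+1 == a) | j < n_ i].
Proof.
by apply/mnmP => j; rewrite !mnmE val_sig2_Rank tagnat.Rank1K eqxx.
Qed.

Lemma mblock_cmon_neq k i a : k != i -> mblock k (cmon i a) = 0%MM.
Proof.
move=> ki; apply/mnmP => j; rewrite !mnmE.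
by have -> : (tagnat.sig1 (tagnat.Rank k j) == i) = false
  by rewrite tagnat.Rank1K (negPf ki).
Qed.

Lemma wdeg_cmon i a : (a <= n_ i)%N -> wdeg (mblock i (cmon i a)) = a.
Proof.
rewrite mblock_cmon /wdeg; case: a => [|a] le_a.
  by rewrite big1 // => l _; rewrite mnmE muln0.
rewrite (bigD1 (Ordinal le_a)) //= mnmE eqxx muln1 big1 ?addn0 // => l nla.
by rewrite mnmE eqSS (_ : (l == a :> nat) = false) ?muln0 //; apply: negPf.
Qed.

Lemma cmon0 i : cmon i 0 = 0%MM.
Proof. by apply/mnmP => k; rewrite mnmE mnm0E andbF. Qed.

Lemma cmonS i (j : 'I_(n_ i)) : cmon i j.+1 = U_(tagnat.Rank i j)%MM.
Proof.
apply/mnmP => k; rewrite mnmE mnm1E eqSS; congr nat_of_bool.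
rewrite -[in RHS](tagnat.sig2K k) -[RHS]val_eqE /= tagnat.eq_Rank.
by rewrite eq_sym; congr (_ && _); rewrite eq_sym.
Qed.

Lemma coef_gfactor i (b : nat) : (gfactor A n_ i)`_b =
  if (b <= n_ i)%N then 'X_[cmon i (n_ i - b)] else 0.
Proof.
rewrite /gfactor coefD coefXn coef_sum.
case: ltngtP => [bn|nb|->].
- have lt_j : (n_ i - b.+1 < n_ i)%N by lia.
  rewrite add0r (bigD1 (Ordinal lt_j)) //= coefZ coefXn.
  rewrite (_ : (b == _) = true) ?mulr1; last by apply/eqP; lia.
  rewrite /cvar -cmonS /= [X in _ + X]big1 ?addr0; first by congr 'X_[cmon i _]; lia.
  move=> j; rewrite -val_eqE /= => nj; rewrite coefZ coefXn.
  by rewrite (_ : (b == _) = false) ?mulr0 //; have := ltn_ord j; lia.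
- rewrite add0r [LHS]big1 // => j _; rewrite coefZ coefXn.
  by rewrite (_ : (b == _) = false) ?mulr0 //; lia.
- rewrite [X in _ + X]big1 ?addr0 => [|j _]; first by rewrite subnn cmon0 mpolyX0.
  by rewrite coefZ coefXn (_ : (_ == _) = false) ?mulr0 //; have := ltn_ord j; lia.
Qed.

Lemma size_gfactor i : size (gfactor A n_ i) = (n_ i).+1.
Proof.
apply/eqP; rewrite eqn_leq; apply/andP; split.
  by apply/leq_sizeP => k nk; rewrite coef_gfactor leqNgt nk.
apply: contraT; rewrite -leqNgt => sg.
have := coef_gfactor i (n_ i); rewrite leqnn subnn cmon0 mpolyX0.
by rewrite nth_default // => /eqP; rewrite eq_sym oner_eq0.
Qed.

Lemma monic_gfactor i : gfactor A n_ i \is monic.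
Proof.
apply/monicP; rewrite /lead_coef size_gfactor coef_gfactor leqnn subnn cmon0.
by rewrite mpolyX0.
Qed.

(** The polynomial h_i such that h_i(x^2) is the product of g_i and its reflection. *)
Definition hfactor i : {poly S} := sqroots (gfactor A n_ i).

Lemma size_hfactor i : size (hfactor i) = (n_ i).+1.
Proof. by rewrite (size_sqroots (monic_gfactor i)).1 size_gfactor. Qed.

Lemma monic_hfactor i : hfactor i \is monic.
Proof. exact: (size_sqroots (monic_gfactor i)).2. Qed.

(** The coefficient at n_i - a is found at 2(n_i - a) in the product, where the terms c_j c_l with j
    + l = 2a contribute; the summation index is b = n_i - j. *)
Lemma coef_hfactor i a : (a <= n_ i)%N -> (hfactor i)`_(n_ i - a) =
  \sum_(b < (n_ i - a).*2.+1 | (b <= n_ i)%N && ((n_ i - a).*2 - b <= n_ i)%N)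
    (-1) ^+ (n_ i + ((n_ i - a).*2 - b)) *:
      'X_[cmon i (n_ i - b) + cmon i (n_ i - ((n_ i - a).*2 - b))].
Proof.
move=> an; rewrite coef_sqroots coefM [RHS]big_mkcond; apply: eq_bigr => b _ /=.
rewrite coef_pstar !coef_gfactor size_gfactor /=.
case: ifP => _ /=; last by rewrite mul0r.
case: ifP => _ /=; last by rewrite !mulr0.
rewrite mpolyXD mulrCA -mul_mpolyC.
by rewrite rmorphXn /= mpolyCN mpolyC1.
Qed.

Lemma msupp_hfactor i a m :
  (a <= n_ i)%N -> m \in msupp (hfactor i)`_(n_ i - a) ->
  exists j l, [/\ (l <= j)%N, (j <= n_ i)%N, (j + l = a + a)%N &
    m = (cmon i j + cmon i l)%MM].
Proof.
move=> an; rewrite coef_hfactor // => /msupp_sum_le.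
case/flatten_mapP => b; rewrite mem_filter => /andP[/andP[bn bn'] _].
move=> /msuppZ_le; rewrite msuppX inE => /eqP ->.
set j := (n_ i - b)%N; set l := (n_ i - _)%N.
have bb := ltn_ord b.
have jl : (j + l = a + a)%N by rewrite /j /l; lia.
have [lj|/ltnW jl'] := leqP l j; [exists j, l | exists l, j]; split=> //.
- by rewrite /j; lia.
- by rewrite /l; lia.
- by rewrite addnC.
- by rewrite addmC.
Qed.

(** Only the pair j = l = a yields c_a^2, and its sign has exponent n_i + (n_i - a), of the parity
    of a. *)
Lemma lead_hfactor i a : (a <= n_ i)%N ->
  ((hfactor i)`_(n_ i - a))@_(cmon i a + cmon i a) = (-1) ^+ a.
Proof.
move=> an; rewrite coef_hfactor // raddf_sum /=.
have lt_b : (n_ i - a < (n_ i - a).*2.+1)%N by lia.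
have e1 : ((n_ i - a).*2 - (n_ i - a) = n_ i - a)%N by lia.
rewrite (bigD1 (Ordinal lt_b)) /=; last by rewrite e1 leq_subr.
rewrite e1 subKn // mcoeffZ mcoeffX eqxx mulr1.
rewrite [X in _ + X]big1 ?addr0.
  by rewrite -signr_odd -[in RHS]signr_odd; congr (_ ^+ nat_of_bool _); lia.
move=> b /andP[/andP[bn bn']]; rewrite -val_eqE /= => nb.
rewrite mcoeffZ mcoeffX; case: eqP => [E|]; last by rewrite mulr0.
have bb := ltn_ord b; exfalso.
(* For any other pair the larger index [j] exceeds [a], so c_j, at position [j.-1] of its block,
   occurs on one side only. *)
pose j := maxn (n_ i - b) (n_ i - ((n_ i - a).*2 - b)).
have lt_j : (j.-1 < n_ i)%N by lia.
have := congr1 (fun m => mblock i m (Ordinal lt_j)) E.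
rewrite /= !mblockD !mnmDE !mblock_cmon !mnmE /=.
have -> : (j.-1.+1 == a) = false by lia.
by rewrite /j; lia.
Qed.

End Factors.

(** * Coefficients of h_i ... h_r and their weight in block i *)

Section Block.
Variables (A : comNzRingType) (r : nat) (n_ : 'I_r -> nat) (i : 'I_r).
Local Notation N := (\sum_(i < r) n_ i)%N.
Local Notation S := {mpoly A[N]}.
Local Notation c := (cmon n_ i).
Local Notation wt m := (wdeg (mblock i m)).
Implicit Types (m : 'X_{1..N}) (p q : S).

(** Monomials free of the blocks before i. Those in the coefficients of h_i ... h_r are of this
    kind, so block i is the first where two of them can differ. *)
Definition above (m : 'X_{1..N}) := forall k : 'I_r, (k < i)%N -> mblock k m = 0%MM.

Lemma above0 : above 0%MM.
Proof. by move=> k _; rewrite mblock0. Qed.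

Lemma aboveD m1 m2 : above m1 -> above m2 -> above (m1 + m2)%MM.
Proof. by move=> a1 a2 k ki; rewrite mblockD a1 // a2 // addm0. Qed.

Lemma above_cmon (j : 'I_r) a : (i <= j)%N -> above (cmon n_ j a).
Proof.
move=> ij k ki; apply: mblock_cmon_neq; apply/eqP => kj; move: ki.
by rewrite kj; lia.
Qed.

Lemma above_sum (T : finType) (f : T -> 'X_{1..N}) :
  (forall t, above (f t)) -> above (\sum_t f t)%MM.
Proof. by move=> af; apply: big_ind => //; [exact: above0 | exact: aboveD]. Qed.

(** Elements in the variables of the blocks after i, hence of weight 0 in block i, such as the
    coefficients of h_{i+1} ... h_r. *)
Definition below p := forall m, m \in msupp p -> above m /\ mblock i m = 0%MM.

Lemma belowD p q : below p -> below q -> below (p + q).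
Proof. by move=> bp bq m /msuppD_le; rewrite mem_cat => /orP[/bp|/bq]. Qed.

Lemma belowM p q : below p -> below q -> below (p * q).
Proof.
move=> bp bq _ /msuppM_le/allpairsP[[m1 m2] /= [/bp[a1 b1] /bq[a2 b2] ->]].
by split; [exact: aboveD | rewrite mblockD b1 b2 addm0].
Qed.

Lemma below_const (a : A) : below a%:MP.
Proof.
move=> m; rewrite msuppC; case: eqP => // _; rewrite inE => /eqP ->.
by split; [exact: above0 | rewrite mblock0].
Qed.

Lemma below0 : below 0.
Proof. by move=> m; rewrite msupp0. Qed.

Definition tailprod : {poly S} := \prod_(j < r | (i < j)%N) hfactor A n_ j.

Lemma size_tailprod : size tailprod = (\sum_(j < r | (i < j)%N) n_ j).+1 /\
  tailprod \is monic.
Proof.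
apply: (big_ind2 (fun (p : {poly S}) k => size p = k.+1 /\ p \is monic)).
- by rewrite size_poly1 monic1.
- move=> p k q l [sp pm] [sq qm]; rewrite size_monicM ?monic_neq0 // rpredM //.
  by rewrite sp sq; split=> //; lia.
- by move=> j _; rewrite size_hfactor monic_hfactor.
Qed.

Lemma below_hfactor (j : 'I_r) (k : nat) : (i < j)%N -> below (hfactor A n_ j)`_k.
Proof.
move=> ij; have [kn|nk] := leqP k (n_ j); last first.
  by rewrite nth_default ?size_hfactor //; exact: below0.
rewrite -(subKn kn) => m /msupp_hfactor [|a [b [_ _ _ ->]]]; first exact: leq_subr.
have ij' : i != j by apply/eqP => ij'; move: ij; rewrite ij' ltnn.
split; first by apply: aboveD; apply: above_cmon; exact: ltnW.
by rewrite mblockD !mblock_cmon_neq // addm0.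
Qed.

Lemma below_tailprod (k : nat) : below tailprod`_k.
Proof.
move: k; apply: (big_ind (fun p : {poly S} => forall k, below p`_k)).
- move=> k; rewrite coefC; case: ifP => _; [exact: below_const | exact: below0].
- move=> p q bp bq k; rewrite coefM; apply: big_ind.
  + exact: below0.
  + exact: belowD.
  + by move=> a _; exact: belowM.
- by move=> j ij k; exact: below_hfactor.
Qed.

Local Notation w' := (\sum_(j < r | (i < j)%N) n_ j)%N.

(** The leading coefficient 1 of the tail contributes a coefficient of h_i, of weight 2(n_i + w' -
    z). Any other product pairs a lower coefficient of the tail, of weight 0 in block i, with a
    higher coefficient of h_i, whose weight is smaller. *)
Lemma coef_upperprod (z : nat) : exists2 P : S,
  (hfactor A n_ i * tailprod)`_z =
    (if (w' <= z)%N then (hfactor A n_ i)`_(z - w') else 0) + P &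
  forall m, m \in msupp P -> above m /\ (wt m + z.*2 < (n_ i + w').*2)%N.
Proof.
have [sT Tm] := size_tailprod; rewrite coefM.
exists (\sum_(b < z.+1 | (z - b != w')%N) (hfactor A n_ i)`_b * tailprod`_(z - b)).
  rewrite (bigID (fun b : 'I_z.+1 => (z - b == w')%N)) /=; congr (_ + _).
  case: leqP => [wz|zw].
    have lt_b : (z - w' < z.+1)%N by lia.
    rewrite (big_pred1 (Ordinal lt_b)) /=.
      rewrite subKn //; move/monicP: Tm; rewrite /lead_coef sT /= => ->.
      by rewrite mulr1.
    by move=> b /=; rewrite -val_eqE /=; have := ltn_ord b; lia.
  by rewrite [LHS]big_pred0 // => b; lia.
move=> m /msupp_sum_le/flatten_mapP[b]; rewrite mem_filter => /andP[/eqP nb _].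
have bz := ltn_ord b.
case: (leqP b (n_ i)) => [bn|nb'] ; last first.
  by rewrite [(hfactor A n_ i)`__]nth_default ?size_hfactor // mul0r msupp0.
case: (leqP (z - b) w') => [zb|zb]; last first.
  by rewrite [tailprod`__]nth_default ?sT // mulr0 msupp0.
move=> /msuppM_le/allpairsP[[m1 m2] /= [+ /below_tailprod[a2 b2] ->]].
rewrite -{1}(subKn bn) => /msupp_hfactor[|j [l [lj jn jl ->]]].
  exact: leq_subr.
split; first by do 2?[apply: aboveD => //]; exact: above_cmon.
rewrite !mblockD !wdegD b2 wdeg0 !wdeg_cmon //; last exact: leq_trans jn.
move: zb nb jl; move: (\sum_(j0 < r | _) _)%N (nat_of_ord b) bn bz => W b' *.
lia.
Qed.

End Block.

(** * The determinants and their leading monomials *)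

Section Shift.
Variables (r : nat) (n_ : 'I_r -> nat) (i : 'I_r).
Local Notation N := (\sum_(i < r) n_ i)%N.
Local Notation c := (cmon n_ i).
Local Notation wt m := (wdeg (mblock i m)).

Lemma sum_perm_ord (k : nat) (s : 'S_k) :
  (\sum_(t < k) s t = \sum_(t < k) t)%N.
Proof.
by rewrite [RHS](reindex_inj (h := s)) //; exact: perm_inj.
Qed.

(* The first row at which the two sides differ is a row with s t > t, and the
   largest index occurring from there on occurs only on the smaller side. *)
Lemma shift_lt (k : nat) (s : 'S_k) (mu a j l : 'I_k -> nat) :
  (forall t, (mu t <= n_ i)%N) ->
  (forall t u : 'I_k, (t <= u)%N -> (mu u <= mu t)%N) ->
  (forall t, (l t <= j t <= n_ i)%N) ->
  (forall t, (j t + l t = a t + a t)%N) ->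
  (forall t, (a t + t = mu t + s t)%N) ->
  ((\sum_t (c (j t) + c (l t)))%MM = (\sum_t (c (mu t) + c (mu t)))%MM /\
    s = 1%g) \/
  block_lt (\sum_t (c (j t) + c (l t)))%MM (\sum_t (c (mu t) + c (mu t)))%MM.
Proof.
move=> mun mudec lj jl ast.
have [/existsP[t1 nt1]|] := boolP [exists t, (j t != mu t) || (l t != mu t)];
  last first.
  rewrite negb_exists => /forallP eqt; left.
  have {}eqt t : j t = mu t /\ l t = mu t.
    by have := eqt t; rewrite negb_or !negbK => /andP[/eqP -> /eqP ->].
  split; first by apply: eq_bigr => t _; rewrite (eqt t).1 (eqt t).2.
  apply/permP => t; rewrite perm1; apply: val_inj => /=.
  by have := jl t; have := ast t; rewrite (eqt t).1 (eqt t).2; lia.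
right; have [t0 nt0 mint0] := @arg_minnP _ t1
  (fun t => (j t != mu t) || (l t != mu t)) (fun t : 'I_k => t : nat) nt1.
have eqt (t : 'I_k) : (t < t0)%N -> j t = mu t /\ l t = mu t.
  move=> tt0; have := contra (mint0 t); rewrite -ltnNge negb_or !negbK.
  by move=> /(_ tt0)/andP[/eqP -> /eqP ->].
have fixt (t : 'I_k) : (t < t0)%N -> s t = t.
  move=> tt0; apply: val_inj => /=.
  by have := jl t; have := ast t; have [-> ->] := eqt t tt0; lia.
have st0 : (t0 <= s t0)%N.
  rewrite leqNgt; apply/negP => st; have := fixt _ st => /perm_inj st'.
  by rewrite st' ltnn in st.
(* [s t0 >= t0] gives [a t0 >= mu t0]; as [j t0] and [l t0] average to [a t0] and are not both
   [mu t0], the larger one exceeds [mu t0]. *)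
have jt0 : (mu t0 < j t0)%N.
  have := jl t0; have := ast t0; have := lj t0; move: nt0.
  by move: (j t0) (l t0) (a t0) (mu t0) => *; lia.
have [t2 t02 maxt2] := @arg_maxnP _ t0
  (fun t : 'I_k => t0 <= t)%N j (leqnn t0).
have {}maxt2 (t : 'I_k) : (t0 <= t)%N -> (j t <= j t2)%N by exact: maxt2.
have jt2 : (mu t0 < j t2)%N by rewrite (leq_trans jt0) // maxt2.
have lt_x : ((j t2).-1 < n_ i)%N by have := lj t2; lia.
apply/block_ltP; exists i; last first.
  move=> b bi; have nbi : b != i by rewrite -val_eqE /=; lia.
  rewrite !mblock_sum; apply: eq_bigr => t _.
  by rewrite !mblockD !mblock_cmon_neq.
have coordE (f g : 'I_k -> nat) (x : 'I_(n_ i)) :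
    mblock i (\sum_t (c (f t) + c (g t)))%MM x =
    (\sum_t ((x.+1 == f t) + (x.+1 == g t)))%N.
  rewrite mblock_sum mnm_sumE; apply: eq_bigr => t _.
  by rewrite mblockD mnmDE !mblock_cmon !mnmE.
have wtE (f g : 'I_k -> nat) : (forall t, (f t <= n_ i)%N) ->
    (forall t, (g t <= n_ i)%N) ->
    wt (\sum_t (c (f t) + c (g t)))%MM = (\sum_t (f t + g t))%N.
  move=> fn gn; rewrite mblock_sum wdeg_sum; apply: eq_bigr => t _.
  by rewrite mblockD wdegD !wdeg_cmon.
(* The weights agree because [s] permutes the rows, so the reverse lexicographic tie-break decides:
   the side with more of the last differing variable is smaller. *)
apply/wgrevlexP; right; split.
  rewrite !wtE //; try by move=> t; have := lj t; lia.
  rewrite (eq_bigr (fun t => a t + a t)%N) => [|t _]; last exact: jl.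
  have : (\sum_t (a t + t) = \sum_t (mu t + s t))%N by apply: eq_bigr => t _.
  by rewrite !big_split /= sum_perm_ord => /addIn ->.
exists (Ordinal lt_x); last first.
  move=> x /= xj; rewrite !coordE; apply: eq_bigr => t _.
  have [/eqt[-> ->] //|t0t] := ltnP t t0.
  have := maxt2 t t0t; have := mudec _ _ t0t; have := lj t.
  by move: (j t) (l t) (mu t) (mu t0) (j t2) jt2 xj => *; lia.
rewrite !coordE /= (bigD1 t2) //= [ltnRHS](bigD1 t2) //=.
rewrite -addSn; apply: leq_add.
  by have := mudec _ _ t02; move: (mu t2) (mu t0) (j t2) jt2 => *; lia.
apply: leq_sum => t _; have [/eqt[-> ->] //|t0t] := ltnP t t0.
have := mudec _ _ t0t.
by move: (j t) (l t) (mu t) (mu t0) (j t2) jt2 => *; lia.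
Qed.

End Shift.

Section Determinant.
Variables (A : comNzRingType) (r : nat) (n_ : 'I_r -> nat) (i : 'I_r).
Local Notation N := (\sum_(i < r) n_ i)%N.
Local Notation S := {mpoly A[N]}.
Local Notation c := (cmon n_ i).
Local Notation wt m := (wdeg (mblock i m)).
Local Notation w' := (\sum_(j < r | (i < j)%N) n_ j)%N.
Variables (F : {poly A}) (d : nat) (mu : 'I_d.+1 -> nat).
Hypothesis mu_bound : forall t, (0 < mu t <= n_ i)%N.
Hypothesis mu_dec : forall t u : 'I_d.+1, (t <= u)%N -> (mu u <= mu t)%N.

Local Notation Fm := (map_poly (@mpolyC N A) F).
Local Notation V := (hfactor A n_ i * tailprod A n_ i).
Local Notation D t := (n_ i + w' + t - mu t)%N.

(* Dual Jacobi-Trudi matrix of the shape with column lengths [mu], corrected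
   in the last column by the coefficients of [F]. *)
Definition jtmx : 'M[S]_d.+1 := \matrix_(t, s)
  ((if (s <= D t)%N then V`_(D t - s) else 0) -
   (if s == d :> nat then Fm`_(D t) else 0)).

Definition jtmon : 'X_{1..N} := (\sum_t (c (mu t) + c (mu t)))%MM.

(** With a = mu t + s - t the main part is a coefficient of h_i, a sum of products c_j c_l with j +
    l = 2a; all the rest has weight below 2a in block i. The bound is written without subtraction,
    as mu t + s may be less than t. *)
Lemma jtmx_entry (t s : 'I_d.+1) : exists2 P : S,
  jtmx t s = (if (t <= mu t + s <= n_ i + t)%N
              then (hfactor A n_ i)`_(n_ i - (mu t + s - t)) else 0) + P &
  forall m, m \in msupp P -> above i m /\ (wt m + t.*2 < (mu t + s).*2)%N.
Proof.
have := mu_bound t => /andP[mu0 mun].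
have [P1 P1E P1low] : exists2 P : S,
  (if (s <= D t)%N then V`_(D t - s) else 0) =
     (if (t <= mu t + s <= n_ i + t)%N
        then (hfactor A n_ i)`_(n_ i - (mu t + s - t)) else 0) + P &
  forall m, m \in msupp P -> above i m /\ (wt m + t.*2 < (mu t + s).*2)%N.
  case: leqP => [sD|Ds]; last first.
    exists 0; last by move=> m; rewrite msupp0.
    rewrite addr0; case: ifP => //; move: Ds; move: w' => W; lia.
  have [P -> Plow] := coef_upperprod A n_ i (D t - s).
  exists P; last first.
    move=> m /Plow[am wm]; split=> //; move: sD wm.
    by move: w' => W; move: (wt m) => *; lia.
  congr (_ + _); have [ts|st] := leqP t (mu t + s) => /=.
    rewrite (_ : (w' <= D t - s)%N = (mu t + s <= n_ i + t)%N); last first.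
      by move: sD; move: w' => W; lia.
    case: ifP => // le_mu; congr (polyseq _)`_ _.
    by move: sD; move: w' => W; lia.
  case: ifP => // le_w; rewrite nth_default // size_hfactor.
  by move: sD le_w; move: w' => W; lia.
rewrite mxE P1E; exists (P1 - (if s == d :> nat then Fm`_(D t) else 0)).
  by rewrite addrA.
move=> m /msuppB_le; rewrite mem_cat => /orP[/P1low //|].
case: eqP => [sd|_]; last by rewrite msupp0.
rewrite coef_map => /(@below_const A r n_ i)[am ->]; split=> //.
(* A coefficient of [F] has weight 0 and enters for [s = d] only, where [t <= d] and [mu t > 0] make
   the inequality strict. *)
by rewrite wdeg0; have := ltn_ord t; lia.
Qed.

Lemma jtmon_wt : wt jtmon = (\sum_t (mu t).*2)%N.
Proof.
rewrite mblock_sum wdeg_sum; apply: eq_bigr => t _.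
by rewrite mblockD wdegD !wdeg_cmon ?addnn //; case/andP: (mu_bound t).
Qed.

Lemma above_jtmon : above i jtmon.
Proof. by apply: above_sum => t; apply: aboveD; exact: above_cmon. Qed.

(** The row bounds 2(mu t + s t - t) sum to the weight of [jtmon], as [s] is a permutation. So one
    factor below its bound makes the whole monomial smaller; otherwise every factor is some c_j c_l
    from a main part and [shift_lt] compares. *)
Lemma jtmx_lt (s : 'S_d.+1) (m : 'X_{1..N}) :
  m \in msupp (\prod_t jtmx t (s t)) ->
  (m = jtmon /\ s = 1%g) \/ block_lt m jtmon.
Proof.
move=> /msupp_prod -/(_ (index_enum_uniq _))[f fM ->].
have {}fM t : above i (f t) /\
    ((wt (f t) + t.*2 < (mu t + s t).*2)%N \/
     exists ajl : nat * nat * nat, let: (a, j, l) := ajl in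
       [/\ (l <= j <= n_ i)%N, (j + l = a + a)%N, (a + t = mu t + s t)%N &
           f t = (c j + c l)%MM]).
  have [P ME Plow] := jtmx_entry t (s t).
  have := fM t (mem_index_enum t); rewrite ME => /msuppD_le; rewrite mem_cat.
  case/orP => [|/Plow[am lm]]; last by split=> //; left.
  case: ifP => [/andP[t_le le_n]|]; last by rewrite msupp0.
  have an : (mu t + s t - t <= n_ i)%N by lia.
  move=> /(msupp_hfactor an)[j [l [lj jn jl ->]]].
  split; first by apply: aboveD; exact: above_cmon.
  right; exists ((mu t + s t - t)%N, j, l); split=> //; first by rewrite lj.
  by rewrite subnK.
have [/existsP[t1 low1]|] :=
    boolP [exists t, (wt (f t) + t.*2 < (mu t + s t).*2)%N].
  right; apply/block_ltP; exists i; last first.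
    move=> k ki; rewrite (above_jtmon ki).
    by apply: (above_sum (i := i) (f := f)) => // t; exact: (fM t).1.
  apply/wgrevlexP; left; rewrite jtmon_wt mblock_sum wdeg_sum.
  have le_t t : (wt (f t) + t.*2 <= (mu t + s t).*2)%N.
    have [_ [/ltnW //|[[[a j] l] [/andP[lj jn] jl ast ->]]]] := fM t.
    rewrite mblockD wdegD !wdeg_cmon //; last exact: leq_trans jn.
    by rewrite jl; lia.
  have : (\sum_t (wt (f t) + t.*2) < \sum_t ((mu t).*2 + (s t).*2))%N.
    rewrite (bigD1 t1) //= [ltnRHS](bigD1 t1) //= -addSn leq_add //.
      by rewrite -doubleD.
    by apply: leq_sum => t _; rewrite -doubleD.
  rewrite !big_split /= [X in (_ < _ + X)%N](_ : _ = (\sum_(t < d.+1) t.*2)%N).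
    by rewrite ltn_add2r.
  by rewrite [RHS](reindex_inj (h := s)) //; exact: perm_inj.
rewrite negb_exists => /forallP nlow.
have /fin_all_exists [g gE] (t : 'I_d.+1) : exists ajl : nat * nat * nat,
    [/\ (ajl.2 <= ajl.1.2 <= n_ i)%N, (ajl.1.2 + ajl.2 = ajl.1.1 + ajl.1.1)%N,
        (ajl.1.1 + t = mu t + s t)%N & f t = (c ajl.1.2 + c ajl.2)%MM].
  have [_ [low|[[[a j] l] ?]]] := fM t; last by exists (a, j, l).
  by have := nlow t; rewrite low.
rewrite (eq_bigr (fun t => (c (g t).1.2 + c (g t).2)%MM)) => [|t _]; last first.
  by case: (gE t).
apply: (shift_lt (a := fun t => (g t).1.1)) => // t.
- by case/andP: (mu_bound t).
- by case: (gE t).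
- by case: (gE t).
- by case: (gE t).
Qed.

Lemma jtmx_diag (t : 'I_d.+1) :
  lead_le (jtmx t t) (c (mu t) + c (mu t))%MM /\
  (jtmx t t)@_(c (mu t) + c (mu t)) = (-1) ^+ mu t.
Proof.
have /andP[mu0 mun] := mu_bound t.
have wt_mu : wt (c (mu t) + c (mu t))%MM = (mu t).*2.
  by rewrite mblockD wdegD !wdeg_cmon // addnn.
have [P -> Plow] := jtmx_entry t t.
rewrite leq_addl leq_add2r mun /= addnK; split; last first.
  rewrite mcoeffD lead_hfactor // [X in _ + X]memN_msupp_eq0 ?addr0 //.
  by apply/negP => /Plow[_]; rewrite wt_mu -doubleD ltnn.
move=> m /msuppD_le; rewrite mem_cat => /orP[|/Plow[am lm]]; last first.
  right; apply/block_ltP; exists i.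
    by apply/wgrevlexP; left; rewrite wt_mu; move: lm; rewrite doubleD ltn_add2r.
  have ab : above i (c (mu t) + c (mu t))%MM.
    by apply: aboveD; exact: above_cmon.
  by move=> k ki; rewrite am // ab.
move=> /(msupp_hfactor mun)[j [l [lj jn jl ->]]].
(* The one-row case of the comparison, with the identity permutation. *)
have := @shift_lt r n_ i 1 1%g (fun=> mu t) (fun=> mu t) (fun=> j) (fun=> l).
rewrite !big_ord1 => /(_ _ _ _ _ _)[] => //.
- by move=> _; rewrite lj.
- by move=> u; rewrite perm1.
- by case; left.
- by right.
Qed.

(** Only the identity permutation reaches [jtmon]. The lead coefficient is a sign, which allows
    division by these determinants over any ring [A]. *)
Lemma jtmx_lead :
  is_lead_mon (\det jtmx) jtmon /\
  (\det jtmx)@_jtmon = (-1) ^+ (\sum_t mu t)%N.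
Proof.
have coefE : (\det jtmx)@_jtmon = (-1) ^+ (\sum_t mu t)%N.
  rewrite /determinant raddf_sum (bigD1 1%g) //= odd_perm1 expr0 mul1r.
  rewrite (eq_bigr (fun t => jtmx t t)) => [|t _]; last by rewrite perm1.
  rewrite lead_le_prod => [|t]; last exact: (jtmx_diag t).1.
  rewrite [X in _ + X]big1 ?addr0 => [|s s1].
    rewrite (eq_bigr (fun t => (-1) ^+ mu t)) => [|t _].
      by rewrite prodrXr.
    exact: (jtmx_diag t).2.
  apply: memN_msupp_eq0; apply/negP; rewrite mulr_sign; case: ifP => _.
    rewrite (perm_mem (msuppN _)).
    by case/jtmx_lt => [[_ s1']|]; [rewrite s1' eqxx in s1 | rewrite block_lt_irr].
  by case/jtmx_lt => [[_ s1']|]; [rewrite s1' eqxx in s1 | rewrite block_lt_irr].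
split=> //; split.
  by rewrite mcoeff_msupp coefE signr_eq0.
move=> m /msupp_sum_le/flatten_mapP[s _].
rewrite mulr_sign; case: ifP => _; rewrite ?(perm_mem (msuppN _)).
  by case/jtmx_lt => [[-> _] /eqP|].
by case/jtmx_lt => [[-> _] /eqP|].
Qed.

End Determinant.

(** List every index [j.+1] with multiplicity [a j], sort decreasingly and keep the first [k]
    entries. *)
Lemma exists_shape (k n : nat) (a : 'I_n -> nat) : (k <= \sum_j a j)%N ->
  exists mu : 'I_k -> nat,
  [/\ forall t, (0 < mu t <= n)%N,
      forall t u : 'I_k, (t <= u)%N -> (mu u <= mu t)%N &
      forall j : 'I_n, (\sum_t (j.+1 == mu t) <= a j)%N].
Proof.
move=> le_k; pose s0 := flatten [seq nseq (a j) j.+1 | j <- enum 'I_n].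
pose s := sort geq s0.
have sz : size s = (\sum_j a j)%N.
  rewrite size_sort size_flatten /shape -map_comp sumnE big_map big_enum.
  by apply: eq_bigr => j _ /=; rewrite size_nseq.
have lt_s (t : 'I_k) : (t < size s)%N by rewrite sz (leq_trans (ltn_ord t)).
exists (fun t => nth 0%N s t); split.
- move=> t; have : nth 0%N s t \in s0 by rewrite -(mem_sort geq) mem_nth.
  case/flatten_mapP => j _; rewrite mem_nseq => /andP[_ /eqP ->].
  by rewrite ltn_ord.
- move=> t u tu; have geq_tr : transitive geq.
    by move=> x y z /= xy yz; exact: leq_trans yz xy.
  have srt : sorted geq s by apply: sort_sorted => x y; exact: leq_total.
  exact: (sorted_leq_nth geq_tr leqnn 0%N srt) (lt_s t) (lt_s u) tu.
- move=> j; have -> : (\sum_(t < k) (j.+1 == nth 0%N s t) =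
      count_mem j.+1 (take k s))%N.
    rewrite -sum1_count [RHS]big_mkcond [RHS](big_nth 0%N) big_mkord.
    rewrite size_takel; last by rewrite sz.
    apply: eq_bigr => t _; rewrite nth_take //= eq_sym; by case: eqP.
  have -> : a j = count_mem j.+1 s.
    rewrite count_sort count_flatten -map_comp sumnE big_map big_enum /=.
    rewrite (bigD1 j) //= count_nseq /= eqxx mul1n big1 ?addn0 // => l lj.
    rewrite count_nseq /= eqSS.
    by rewrite (_ : (l == j :> nat) = false) //; apply: negPf.
  by rewrite -[X in (_ <= count _ X)%N](cat_take_drop k s) count_cat leq_addr.
Qed.

(** * The determinants lie in the ideal *)

Section Membership.
Import Pdiv.CommonRing Pdiv.RingMonic.
Variables (A : comNzRingType) (r : nat) (n_ : 'I_r -> nat).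
Local Notation N := (\sum_(i < r) n_ i)%N.
Local Notation S := {mpoly A[N]}.
Definition hprod : {poly S} := \prod_(i < r) hfactor A n_ i.

Lemma PFiso_divisorE : PFiso_divisor A n_ = hprod \Po 'X^2.
Proof.
rewrite /PFiso_divisor -big_split /hprod rmorph_prod; apply: eq_bigr => i _.
exact: mul_pstar.
Qed.

Lemma monic_hprod : hprod \is monic.
Proof. by apply: monic_prod => i _; exact: monic_hfactor. Qed.

Lemma size_hprod : size hprod = N.+1.
Proof.
suff [] : size hprod = N.+1 /\ hprod \is monic by [].
apply: (big_ind2 (fun (p : {poly S}) k => size p = k.+1 /\ p \is monic)).
- by rewrite size_poly1 monic1.
- move=> p k q l [sp pm] [sq qm]; rewrite size_monicM ?monic_neq0 // rpredM //.
  by rewrite sp sq; split=> //; lia.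
- by move=> j _; rewrite size_hfactor monic_hfactor.
Qed.

(** Substituting x^2 in the division identity doubles the degrees of divisor and remainder alike, so
    the remainder stays small enough. *)
Lemma comp_X2_rmodp (p q : {poly S}) : q \is monic ->
  rmodp (p \Po 'X^2) (q \Po 'X^2) = rmodp p q \Po 'X^2.
Proof.
move=> qm; rewrite {1}(rdivp_eq qm p) comp_polyD comp_polyM.
apply: rmodp_addl_mul_small; first exact: monic_comp_X2.
have q0 := monic_neq0 qm.
have sq : size q = (size q).-1.+1 by rewrite prednK // size_poly_gt0.
rewrite [ltnRHS](size_comp_X2 sq); have rlt := ltn_rmodpN0 p q0.
have [->|r0] := eqVneq (rmodp p q) 0; first by rewrite comp_poly0 size_poly0.
have sr : size (rmodp p q) = (size (rmodp p q)).-1.+1.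
  by rewrite prednK // size_poly_gt0.
by rewrite [ltnLHS](size_comp_X2 sr); rewrite !ltnS ltn_double -ltnS -sr -sq.
Qed.

Variables (n : nat) (F : {poly A}).
Hypotheses (Fm : F \is monic) (sF : size F = n.+1) (n_le : (N <= n)%N).

Local Notation J := (PFiso_ideal n_ (F \Po 'X^2)).
Local Notation FS := (map_poly (@mpolyC N A) F).

Lemma rem_in_ideal (k : nat) : J (rmodp FS hprod)`_k.
Proof.
(* The remainder defining J is that of F by h_1 ... h_r with x^2 substituted, so its coefficient k
   sits at 2k. *)
apply: ideal_gen_mem; exists k.*2.
have -> : map_poly (@mpolyC N A) (F \Po 'X^2) = FS \Po 'X^2.
  by rewrite map_comp_poly map_polyXn.
rewrite PFiso_divisorE comp_X2_rmodp ?monic_hprod //.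
by rewrite coef_comp_poly_Xn // -muln2 dvdn_mull // mulnK.
Qed.

Section Fixed.
Variables (i : 'I_r) (d : nat).
Hypothesis nE : n = (n_ i + \sum_(j < r | (i < j)%N) n_ j + d)%N.
Local Notation V := (hfactor A n_ i * tailprod A n_ i).
Local Notation w := (n_ i + \sum_(j < r | (i < j)%N) n_ j)%N.

(** Take the quotient of F by h_1 ... h_r times the factors h_j with j < i; then V Q differs from F
    by the remainder, whose coefficients lie in J. *)
Lemma cofactor_exists : exists2 Q : {poly S},
  size Q = d.+1 /\ Q \is monic & forall k, J (V * Q - FS)`_k.
Proof.
have [sT Tm] := size_tailprod A n_ i.
have Vm : V \is monic by rewrite rpredM // monic_hfactor.
have sV : size V = w.+1.
  by rewrite size_monicM ?monic_hfactor ?monic_neq0 // size_hfactor sT; lia.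
pose U : {poly S} := \prod_(j < r | (j < i)%N) hfactor A n_ j.
have Um : U \is monic by apply: monic_prod => j _; exact: monic_hfactor.
have HE : hprod = U * V.
  rewrite /hprod [LHS](bigD1 i) //= mulrCA; congr (_ * _).
  rewrite [LHS](bigID (fun j : 'I_r => (j < i)%N)) /=; congr (_ * _).
    by apply: eq_bigl => j; rewrite -val_eqE /=; lia.
  by apply: eq_bigl => j; rewrite -val_eqE /=; lia.
have FSm : FS \is monic by rewrite monic_map.
have sFS : size FS = n.+1 by rewrite size_monic_map.
have qm : rdivp FS hprod \is monic.
  by rewrite rdivp_monic ?monic_hprod // size_hprod sFS.
exists (rdivp FS hprod * U).
  split; last by rewrite rpredM.
  have := size_rdivp_monic FSm monic_hprod; rewrite size_hprod sFS => /(_ n_le).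
  have : size hprod = (size U + w)%N.
    by rewrite HE size_monicM ?monic_neq0 // sV addnS.
  rewrite size_hprod size_monicM ?(monic_neq0 Um) //.
  have := size_poly_gt0 U; rewrite (monic_neq0 Um) => U0.
  by move: nE; move: (size _) (size U) U0 => x y *; lia.
move=> k.
have -> : V * (rdivp FS hprod * U) - FS = - rmodp FS hprod.
  rewrite {2}(rdivp_eq monic_hprod FS) opprD addrA HE.
  by rewrite [V * _]mulrC -mulrA subrr add0r.
by rewrite coefN; apply: ideal_genN; exact: rem_in_ideal.
Qed.

Variable mu : 'I_d.+1 -> nat.

(* By the choice of its rows, [jtmx] maps the coefficient vector of the cofactor
   of [V] in [F] into [J]; the last entry of that vector is 1. *)
Lemma det_in_ideal : J (\det (jtmx n_ i F mu)).
Proof.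
have [Q [sQ Qm] QJ] := cofactor_exists.
pose M := jtmx n_ i F mu; pose q : 'cV[S]_d.+1 := \col_s Q`_s.
have Qd : Q`_d = 1 by move/monicP: Qm; rewrite /lead_coef sQ.
have MqJ t : J ((M *m q) t 0).
  set D := (w + t - mu t)%N.
  (* Since the last coefficient of [Q] is 1, the correction in the last column subtracts exactly the
     coefficient of [F]. *)
  suff -> : (M *m q) t 0 = (V * Q - FS)`_D by exact: QJ.
  rewrite mxE coefB [V * Q]mulrC coefM.
  rewrite (eq_bigr (fun s : 'I_d.+1 =>
    (if (s <= D)%N then V`_(D - s) * Q`_s else 0) -
    (if s == ord_max then FS`_D * Q`_s else 0))) => [|s _]; last first.
    rewrite !mxE -/D mulrBl -val_eqE /=.
    by congr (_ - _); case: ifP => _ //; rewrite mul0r.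
  rewrite sumrB -big_mkcond -[X in _ - X]big_mkcond /= big_pred1_eq Qd mulr1.
  congr (_ - _).
  rewrite (big_ord_widen_cond (d + D).+1 (fun s => s <= D)%N
    (fun s => V`_(D - s) * Q`_s)) ?ltnS ?leq_addr //.
  rewrite (big_ord_widen (d + D).+1 (fun s => Q`_s * V`_(D - s)))
    ?ltnS ?leq_addl //.
  rewrite [LHS]big_mkcond [RHS]big_mkcond /=; apply: eq_bigr => s _.
  rewrite !ltnS; case: (leqP s D) => //= _; case: leqP => ds; first exact: mulrC.
  by rewrite nth_default ?mul0r // sQ.
(* Multiplying by the adjugate turns M q into det M times q, whose last entry is det M. *)
have detE : \det M = (\adj M *m (M *m q)) ord_max 0.
  by rewrite mulmxA mul_adj_mx mul_scalar_mx mxE [q _ _]mxE /= Qd mulr1.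
rewrite detE mxE; apply: ideal_gen_sum => t _ _; exact: ideal_genM (MqJ t).
Qed.

End Fixed.

(** The hypothesis says that [m] is divisible by the square of a monomial of degree d + 1 in block
    i; [exists_shape] writes one as a sequence [mu], and the determinant for [mu] has its square as
    lead monomial. *)
Lemma PFiso_lead (i : 'I_r) (m : 'X_{1..N}) :
  (n - \sum_(j < r | (i <= j)%N) n_ j < \sum_j (mblock i m j)./2)%N ->
  exists G M t e, [/\ J G, is_lead_mon G M, G@_M = (-1) ^+ e & m = (t + M)%MM].
Proof.
set d := (n - _)%N => dm.
have sumE : (\sum_(j < r | (i <= j)%N) n_ j =
    n_ i + \sum_(j < r | (i < j)%N) n_ j)%N.
  rewrite (bigD1 i) //=; congr (_ + _)%N; apply: eq_bigl => j.
  by rewrite -val_eqE /=; lia.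
have nE : n = (n_ i + \sum_(j < r | (i < j)%N) n_ j + d)%N.
  rewrite -sumE /d subnKC // (leq_trans _ n_le) //.
  by rewrite [leqRHS](bigID (fun j : 'I_r => (i <= j)%N)) /= leq_addr.
have [mu [mu_bound mu_dec mu_le]] := exists_shape dm.
have [Glead Gcoef] := jtmx_lead F mu_bound mu_dec.
have Gin := det_in_ideal nE mu.
exists (\det (jtmx n_ i F mu)), (jtmon n_ i mu), (m - jtmon n_ i mu)%MM, (\sum_t mu t)%N.
split=> //; rewrite submK //; apply/mnm_lepP => k.
rewrite -(tagnat.sig2K k); move: (tagnat.sig1 k) (tagnat.sig2 k) => i' j {k}.
have -> (m0 : 'X_{1..N}) : m0 (tagnat.Rank i' j) = mblock i' m0 j by rewrite mnmE.
rewrite mblock_sum mnm_sumE.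
have [ii|ni] := eqVneq i' i; last first.
  by rewrite big1 // => t _; rewrite mblockD !mblock_cmon_neq // addm0 mnm0E.
rewrite {i'}ii in j *; have le_j := mu_le j.
rewrite (eq_bigr (fun t => 2 * (j.+1 == mu t))%N) => [|t _]; last first.
  by rewrite mblockD mnmDE mblock_cmon !mnmE mul2n addnn.
move: le_j; rewrite -big_distrr /= [mblock i m j]mnmE => le_j.
apply: leq_trans (leq_mul (leqnn 2) le_j) _.
by rewrite mul2n -[leqRHS]odd_double_half leq_addl.
Qed.

End Membership.

(** * Reduction to standard monomials *)

Section IdealSum.
Variables (R : comNzRingType) (r : nat) (G : 'I_r -> R -> Prop).
Local Notation I := (ideal_sum (fun i => ideal_gen (G i))).

Lemma ideal_sum0 : I 0.
Proof. by exists (fun=> 0) => [i|]; [exact: ideal_gen0 | rewrite big1]. Qed.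

Lemma ideal_sumD p q : I p -> I q -> I (p + q).
Proof.
move=> [f fG ->] [g gG ->]; exists (fun i => f i + g i).
  by move=> i; exact: ideal_genD.
by rewrite big_split.
Qed.

Lemma ideal_sumM p q : I q -> I (p * q).
Proof.
move=> [f fG ->]; exists (fun i => p * f i); last by rewrite mulr_sumr.
by move=> i; exact: ideal_genM.
Qed.

Lemma ideal_sum_mem i p : ideal_gen (G i) p -> I p.
Proof.
move=> Gp; exists (fun j => if j == i then p else 0).
  by move=> j; case: eqP => [->|_] //; exact: ideal_gen0.
by rewrite -big_mkcond big_pred1_eq.
Qed.

Lemma ideal_sum_seq (T : eqType) (s : seq T) (F : T -> R) :
  (forall t, t \in s -> I (F t)) -> I (\sum_(t <- s) F t).
Proof.
move=> IF; rewrite big_seq; elim/big_ind: _ => [||t /IF //].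
- exact: ideal_sum0.
- exact: ideal_sumD.
Qed.

End IdealSum.

Section Standard.
Variables (A : comNzRingType) (r : nat) (n_ : 'I_r -> nat) (n : nat).
Local Notation N := (\sum_(i < r) n_ i)%N.
Local Notation S := {mpoly A[N]}.
Local Notation bdeg i m := (\sum_j mblock i m j)%N.
Local Notation rest i := (n - \sum_(j < r | (i <= j)%N) n_ j)%N.
Local Notation RHS := (ideal_sum (fun i : 'I_r =>
  ideal_Sq (ideal_pow (block_ideal A n_ i) (rest i + 1)%N))).

(** The monomials outside the right-hand side: the sum of the rounded halves is the largest degree
    of a monomial in block i whose square divides [m]. *)
Definition standard (m : 'X_{1..N}) : bool :=
  [forall i, (\sum_j (mblock i m j)./2 <= rest i)%N].

(** Every monomial of a product of k elements of the block ideal has degree at least k in the block;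
    conversely [exists_shape] picks k variables whose product divides [m]. *)
Lemma ideal_pow_monomial (i : 'I_r) (k : nat) (m : 'X_{1..N}) :
  ideal_pow (block_ideal A n_ i) k 'X_[m] <-> (k <= bdeg i m)%N.
Proof.
split=> [|/exists_shape[mu [mu_bound _ mu_le]]].
  move=> [s sG sE]; have : m \in msupp 'X_[A, m] by rewrite msuppX mem_head.
  rewrite sE => /msupp_sum_le/flatten_mapP[t]; rewrite filter_predT => ts.
  have [a aI ->] := sG t ts.
  move=> /msuppM_le/allpairsP[[m1 m2] /= [_ + ->]].
  move=> /msupp_prod -/(_ (index_enum_uniq _))[f fa ->].
  rewrite mblockD mblock_sum.
  under eq_bigr => j _ do rewrite mnmDE mnm_sumE.
  rewrite big_split /= exchange_big /=.
  apply: leq_trans (leq_addl _ _).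
  rewrite -[X in (X <= _)%N]card_ord -sum1_card; apply: leq_sum => u _.
  have [s' sG' aE] := aI u; have := fa u (mem_index_enum u).
  rewrite aE => /msupp_sum_le/flatten_mapP[v]; rewrite filter_predT => vs.
  have [j ->] := sG' v vs.
  move=> /msuppM_le/allpairsP[[m3 m4] /= [_ + ->]].
  rewrite /cvar msuppX inE => /eqP ->.
  rewrite (bigD1 j) //= mblockD mnmDE [mblock i U_(_)%MM j]mnmE mnm1E eqxx.
  by rewrite addn1 addSn.
pose M := (\sum_t cmon n_ i (mu t))%MM.
have Mm : (M <= m)%MM.
  apply/mnm_lepP => k'; rewrite -(tagnat.sig2K k').
  move: (tagnat.sig1 k') (tagnat.sig2 k') => i' j {k'}.
  have E (m0 : 'X_{1..N}) : m0 (tagnat.Rank i' j) = mblock i' m0 j.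
    by rewrite mnmE.
  rewrite !{}E mblock_sum mnm_sumE; have [ii|ni] := eqVneq i' i; last first.
    by rewrite big1 // => t _; rewrite mblock_cmon_neq // mnm0E.
  rewrite {i'}ii in j *; apply: leq_trans (mu_le j).
  by apply: leq_sum => t _; rewrite mblock_cmon mnmE.
rewrite -(submK Mm) mpolyXD; apply: ideal_genM; apply: ideal_gen_mem.
exists (fun t => 'X_[cmon n_ i (mu t)]) => [t|]; last by rewrite mprodXE.
have /andP[mu0 mun] := mu_bound t.
have lt_mu : ((mu t).-1 < n_ i)%N by rewrite prednK.
apply: ideal_gen_mem; exists (Ordinal lt_mu).
by rewrite /cvar -cmonS /= prednK.
Qed.

Lemma nonstandard_in (m : 'X_{1..N}) : ~~ standard m -> RHS 'X_[m].
Proof.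
rewrite negb_forall => /existsP[i]; rewrite -ltnNge => lt_i.
pose m2 : 'X_{1..N} := [multinom if tagnat.sig1 k == i then (m k)./2 else 0%N
  | k < N].
have le_m2 : (m2 + m2 <= m)%MM.
  by apply/mnm_lepP => k; rewrite mnmDE mnmE; case: ifP => _; lia.
rewrite -(submK le_m2) mpolyXD; apply: ideal_sumM; apply: (ideal_sum_mem (i := i)).
apply: ideal_gen_mem; exists m2; last by rewrite mpolyXD.
apply/ideal_pow_monomial; rewrite addn1; apply: leq_trans lt_i _.
by apply: leq_sum => j _; rewrite !mnmE tagnat.Rank1K eqxx.
Qed.

Variable F : {poly A}.
Hypotheses (Fm : F \is monic) (sF : size F = n.+1) (n_le : (N <= n)%N).
Local Notation J := (PFiso_ideal n_ (F \Po 'X^2)).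

Lemma squares_in_lead (p : S) : RHS p -> lead_ideal n_ J p.
Proof.
move=> [q qI ->]; apply: ideal_gen_sum => i _ _; move: (q i) (qI i) => {}p.
apply: ideal_gen_sub => _ [m /ideal_pow_monomial mI ->].
have : (rest i < \sum_j (mblock i (m + m)%MM j)./2)%N.
  rewrite -addn1; apply: leq_trans mI _; apply: leq_sum => j _.
  by rewrite mblockD mnmDE addnn doubleK.
move=> /(PFiso_lead Fm sF n_le)[G [M [t [e [GJ Glead Ge mE]]]]].
rewrite ['X_[m] ^+ 2]expr2 -mpolyXD mE mpolyXD.
(* The lead coefficient is a sign, so the monomial itself is a multiple of the lead term. *)
have -> : 'X_[A, M] = ((-1) ^+ e)%:MP * (G@_M *: 'X_[M]).
  by rewrite Ge mul_mpolyC scalerA -expr2 sqrr_sign scale1r.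
do 2!apply: ideal_genM; apply: ideal_gen_mem; exists G, M; split=> //.
by apply/eqP => G0; case: Glead; rewrite G0 msupp0.
Qed.

(** [p'] is a normal form of [q] modulo J. The bound by monomials of [q] ensures that reduction does
    not raise lead monomials. *)
Definition reduces (q p' : S) := J (q - p') /\
  forall m', m' \in msupp p' -> standard m' /\
    exists2 m, m \in msupp q & m' = m \/ block_lt m' m.

Lemma reduces_comb (q : S) :
  (forall m, m \in msupp q -> exists p', reduces 'X_[m] p') ->
  exists p', reduces q p'.
Proof.
move=> red; suff [p' [p'J p'std]] : exists p',
    J (\sum_(m <- msupp q) q@_m *: 'X_[m] - p') /\
    forall m', m' \in msupp p' -> standard m' /\
      exists2 m, m \in msupp q & m' = m \/ block_lt m' m.
  by exists p'; split=> //; rewrite [q in q - _]mpolyE.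
have : {subset msupp q <= msupp q} by [].
elim: {1 3}(msupp q) => [|m s IH] sub.
  exists 0; rewrite big_nil subr0; split; first exact: ideal_gen0.
  by move=> m'; rewrite msupp0.
have [|p1 [p1J p1std]] := IH; first by move=> x xs; apply: sub; rewrite inE xs orbT.
have mq : m \in msupp q by apply: sub; rewrite mem_head.
have [p2 [p2J p2std]] := red m mq.
exists (q@_m *: p2 + p1); rewrite big_cons opprD addrACA; split.
  apply: ideal_genD => //; rewrite -scalerBr -mul_mpolyC; exact: ideal_genM.
move=> m' /msuppD_le; rewrite mem_cat => /orP[/msuppZ_le/p2std|/p1std //].
move=> [std [m0]]; rewrite msuppX inE => /eqP -> lt; split=> //.
by exists m.
Qed.

Lemma reduces_monomial (m : 'X_{1..N}) : exists p', reduces 'X_[m] p'.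
Proof.
elim/(well_founded_ind (@block_lt_wf r n_)): m => m IH.
have [std|] := boolP (standard m).
  exists 'X_[m]; split; first by rewrite subrr; exact: ideal_gen0.
  move=> m'; rewrite msuppX inE => /eqP ->; split=> //.
  by exists m; [rewrite mem_head | left].
rewrite negb_forall => /existsP[i]; rewrite -ltnNge.
move=> /(PFiso_lead Fm sF n_le)[G [M [t [e [GJ [MG Glt] Ge mE]]]]].
(* The multiple of [G] with lead monomial [m] cancels [m] exactly and leaves smaller monomials, to
   which the induction applies. *)
pose q : S := 'X_[m] - (-1) ^+ e *: (G * 'X_[t]).
have qlt m' : m' \in msupp q -> block_lt m' m.
  have [->|nm] := eqVneq m' m.
    rewrite mcoeff_msupp mcoeffB mcoeffX eqxx mcoeffZ mE mcoeffMX Ge.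
    by rewrite -expr2 sqrr_sign subrr eqxx.
  move=> /msuppB_le; rewrite mem_cat msuppX inE (negPf nm) /=.
  move=> /msuppZ_le; rewrite (perm_mem (msuppMX _ _)) => /mapP[m1 m1G m'E].
  have [m1M|n1] := eqVneq m1 M.
    by move: nm; rewrite m'E m1M mE addmC eqxx.
  by rewrite m'E mE ![(t + _)%MM]addmC; apply: block_ltD2r; exact: Glt.
have [p' [p'J p'std]] : exists p', reduces q p'.
  by apply: reduces_comb => m' /qlt /IH.
exists p'; split.
  have -> : 'X_[m] - p' = (q - p') + (-1) ^+ e *: (G * 'X_[t]).
    by rewrite /q addrAC subrK.
  apply: ideal_genD => //; rewrite -mul_mpolyC; apply: ideal_genM.
  by rewrite mulrC; exact: ideal_genM.
move=> m' /p'std[std [m0 /qlt lt0 m'm0]]; split=> //.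
exists m; first by rewrite msuppX mem_head.
by right; case: m'm0 => [->|] // /block_lt_trans; apply.
Qed.

Lemma standard_reduction (q : S) : exists p', reduces q p'.
Proof. by apply: reduces_comb => m _; exact: reduces_monomial. Qed.

(** If the lead monomial of some q in J were standard, reducing the rest of q would give strictly
    smaller standard monomials; the lead term plus this normal form would be a nonzero combination
    of standard monomials in J. *)
Lemma lead_in_squares :
  (forall p, J p -> {in msupp p, forall m, standard m} -> p = 0) ->
  forall p, lead_ideal n_ J p -> RHS p.
Proof.
move=> indep p [s sG ->].
apply: ideal_sum_seq => t /sG[q [m [qJ _ [mq mlt] ->]]].
apply: ideal_sumM; rewrite -mul_mpolyC; apply: ideal_sumM.
apply: nonstandard_in; apply/negP => mstd.
have [p' [p'J p'std]] := standard_reduction (q - q@_m *: 'X_[m]).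
have lt_m m' : m' \in msupp (q - q@_m *: 'X_[m]) -> block_lt m' m.
  have [->|nm] := eqVneq m' m.
    by rewrite mcoeff_msupp mcoeffB mcoeffZ mcoeffX eqxx mulr1 subrr eqxx.
  move=> /msuppB_le; rewrite mem_cat => /orP[m'q|/msuppZ_le].
    exact: mlt.
  by rewrite msuppX inE (negPf nm).
have lt_p' m' : m' \in msupp p' -> block_lt m' m.
  move=> /p'std[_ [m0 /lt_m lt0 m'm0]].
  by case: m'm0 => [->|] // /block_lt_trans; apply.
have q0 : q@_m *: 'X_[m] + p' = 0.
  apply: indep.
    have -> : q@_m *: 'X_[m] + p' = q + - (q - q@_m *: 'X_[m] - p').
      by rewrite !opprB addrCA [q + _]addrC subrK addrC.
    by apply: ideal_genD => //; exact: ideal_genN.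
  move=> m' /msuppD_le; rewrite mem_cat => /orP[/msuppZ_le|/p'std[] //].
  by rewrite msuppX inE => /eqP ->.
move: mq; rewrite mcoeff_msupp; move/(congr1 (mcoeff m)): q0.
rewrite mcoeffD mcoeffZ mcoeffX eqxx mulr1 mcoeff0.
rewrite [p'@_m]memN_msupp_eq0 ?addr0 => [-> /eqP //|].
by apply/negP => /lt_p'; rewrite block_lt_irr.
Qed.

End Standard.

(** * Independence of the standard monomials *)

(** Over a commutative nonzero ring T U = 1 forces a <= b, so the matrices are square and a
    one-sided inverse is two-sided. *)
Lemma mulmx1C_leq (A : comNzRingType) (a b : nat) (T : 'M[A]_(a, b))
    (U : 'M[A]_(b, a)) : (b <= a)%N -> T *m U = 1%:M -> U *m T = 1%:M.
Proof.
move=> le_ba TU; have ab : a = b.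
  by apply/eqP; rewrite eqn_leq le_ba (mulmx1_min TU).
by subst b; exact: mulmx1C.
Qed.

(** Writing [e] in terms of [s] and [s] in terms of [e] gives T U = 1 by freeness of [e], and U T =
    1 by the size bound. A relation among the [s i] is a row vector killed by U, hence zero. *)
Lemma spanning_free (A B : comNzRingType) (phi : {rmorphism A -> B})
    (I J : finType) (s : I -> B) (e : J -> B) :
  (forall c : J -> A, \sum_j phi (c j) * e j = 0 -> forall j, c j = 0) ->
  (forall b, spans phi e b) -> (forall b, spans phi s b) -> (#|I| <= #|J|)%N ->
  forall c : I -> A, \sum_i phi (c i) * s i = 0 -> forall i, c i = 0.
Proof.
move=> free_e span_e span_s le_IJ c c0.
have /fin_all_exists [T TE] j := span_s (e j).
have /fin_all_exists [U UE] i := span_e (s i).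
pose MT := \matrix_(j < #|J|, i < #|I|) T (enum_val j) (enum_val i).
pose MU := \matrix_(i < #|I|, j < #|J|) U (enum_val i) (enum_val j).
have sumU (v : I -> A) : \sum_i phi (v i) * s i =
    \sum_j phi (\sum_i v i * U i j) * e j.
  under eq_bigr => i _ do rewrite UE mulr_sumr.
  rewrite exchange_big; apply: eq_bigr => j _.
  rewrite rmorph_sum mulr_suml; apply: eq_bigr => i _.
  by rewrite rmorphM mulrA.
have TU : MT *m MU = 1%:M.
  apply/matrixP => j j'; rewrite !mxE.
  have c0' : \sum_k phi (\sum_i T (enum_val j) i * U i k -
      (enum_val j == k)%:R) * e k = 0.
    under eq_bigr => k _ do rewrite rmorphB mulrBl.
    rewrite sumrB -sumU -TE (bigD1 (enum_val j)) //= eqxx rmorph1 mul1r.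
    rewrite big1 ?addr0 ?subrr // => k nk.
    by rewrite eq_sym (negPf nk) rmorph0 mul0r.
  have /eqP := free_e _ c0' (enum_val j').
  rewrite subr_eq0 (inj_eq enum_val_inj) => /eqP <-.
  rewrite (reindex _ (onW_bij _ (enum_val_bij I))) /=.
  by apply: eq_bigr => i _; rewrite !mxE.
have UT := mulmx1C_leq le_IJ TU.
pose v : 'rV_#|I| := \row_i c (enum_val i).
have vU : v *m MU = 0.
  apply/rowP => j; rewrite !mxE.
  move: c0; rewrite sumU => /free_e/(_ (enum_val j)).
  rewrite (reindex _ (onW_bij _ (enum_val_bij I))) /= => E.
  rewrite -[RHS]E; by apply: eq_bigr => i _; rewrite !mxE.
have v0 : v = 0 by rewrite -[v]mulmx1 -UT mulmxA vU mul0mx.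
by move=> i; have := congr1 (fun u : 'rV_ _ => u 0 (enum_rank i)) v0;
  rewrite !mxE enum_rankK.
Qed.

(** * Counting standard monomials *)

Section Counting.
Variables (r : nat) (n_ : 'I_r -> nat) (n : nat).
Local Notation N := (\sum_(i < r) n_ i)%N.
Local Notation rest i := (n - \sum_(j < r | (i <= j)%N) n_ j)%N.
Hypothesis n_le : (N <= n)%N.

(** The i-th factor is (n_i + rest i)! / (rest i)!, and n_i + rest i is the [rest] of the next
    block, or n for the last one, so the product telescopes. *)
Lemma prod_binomials :
  (\prod_(i < r) ('C(n_ i + rest i, n_ i) * (n_ i)`!) * (n - N)`! = n`!)%N.
Proof.
suff H k : (k <= r)%N ->
    (\prod_(i < r | (r - k <= i)%N) ('C(n_ i + rest i, n_ i) * (n_ i)`!) *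
     (n - \sum_(j < r | (r - k <= j)%N) n_ j)`! = n`!)%N.
  by have := H r (leqnn r); rewrite subnn.
elim: k => [|k IH] kr.
  have no (i : 'I_r) : (r - 0 <= i)%N = false by have := ltn_ord i; lia.
  by rewrite !big_pred0 // subn0 mul1n.
have lt_k : (r - k.+1 < r)%N by lia.
pose i0 := Ordinal lt_k; rewrite -[RHS](IH (ltnW kr)).
have split_i (i : 'I_r) : ((r - k.+1 <= i) && (i != i0))%N = (r - k <= i)%N.
  by rewrite -val_eqE /=; lia.
rewrite (bigD1 i0) //= (eq_bigl _ _ split_i).
have sumE : (\sum_(j < r | (r - k.+1 <= j)%N) n_ j =
    n_ i0 + \sum_(j < r | (r - k <= j)%N) n_ j)%N.
  by rewrite (bigD1 i0) //= (eq_bigl _ _ split_i).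
have le_n : (n_ i0 + \sum_(j < r | (r - k <= j)%N) n_ j <= n)%N.
  rewrite -sumE (leq_trans _ n_le) //.
  by rewrite [leqRHS](bigID (fun j : 'I_r => (r - k.+1 <= j)%N)) /= leq_addr.
rewrite mulnAC mulnC; congr (_ * _)%N; rewrite sumE.
move: le_n; move: (\sum_(j < r | _) n_ j)%N (n_ i0) => W a le_n.
rewrite -mulnA (_ : a + (n - (a + W)) = n - W)%N; last by lia.
have -> : (n - (a + W) = n - W - a)%N by lia.
by apply: bin_fact; lia.
Qed.

(** In each block a standard monomial is determined by the parities of its exponents and by their
    halves, an [n_ i]-tuple of sum at most [rest i]; the binomial coefficient counts such tuples.
    The degree bound [b] makes the type finite. *)
Lemma card_standard (b : nat) :
  (#|{: {m : 'X_{1..N < b} | standard n (val m)}}| <=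
   \prod_(i < r) (2 ^ n_ i * 'C(n_ i + rest i, n_ i)))%N.
Proof.
pose U i := ({ffun 'I_(n_ i) -> bool} * (n_ i).-tuple 'I_(rest i).+1)%type.
pose P (i : 'I_r) : pred (U i) :=
  fun u => (\sum_(x <- u.2) x <= rest i)%N.
pose h (m : {m : 'X_{1..N < b} | standard n (val m)}) : {dffun forall i, U i} :=
  [ffun i => ([ffun j => odd (mblock i (val m) j)],
              [tuple inord (mblock i (val m) j)./2 | j < n_ i])].
have hP m : h m \in family P.
  apply/familyP => i; rewrite /h ffunE unfold_in /= /P /= big_map.
  have /forallP/(_ i) := valP m; apply: leq_trans.
  rewrite [leqLHS]big_enum; apply: leq_sum => j _ /=.
  have := valP m => /forallP/(_ i).
  rewrite (bigD1 j) //= => le_j; rewrite inordK // ltnS.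
  exact: leq_trans (leq_addr _ _) le_j.
have h_inj : injective h.
  move=> m1 m2 hE; apply/val_inj/val_inj/mblock_inj => i; apply/mnmP => j.
  have := congr1 (fun f : {dffun forall i, U i} => f i) hE.
  rewrite !ffunE => uE.
  have hj := congr1 (fun u : U i => val (tnth u.2 j)) uE.
  have oj := congr1 (fun u : U i => u.1 j) uE.
  move: hj oj; rewrite !tnth_mktuple !ffunE /=.
  have lt_half (m : {m : 'X_{1..N < b} | standard n (val m)}) :
      ((mblock i (val m) j)./2 < (rest i).+1)%N.
    have := valP m => /forallP/(_ i); rewrite (bigD1 j) //= => le_j.
    by rewrite ltnS; exact: leq_trans (leq_addr _ _) le_j.
  rewrite (inordK (lt_half m1)) (inordK (lt_half m2)) => hj oj.
  by rewrite -[LHS]odd_double_half -[RHS]odd_double_half oj hj.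
rewrite -(card_imset _ h_inj).
have /subset_leq_card : [set h m | m : {m : 'X_{1..N < b} | standard n (val m)}]
    \subset family P.
  by apply/subsetP => _ /imsetP[m _ ->].
move/leq_trans; apply; rewrite card_family foldrE big_map big_enum /=.
apply: leq_prod => i _.
rewrite -(card_partial_ord_partitions (n_ i) (rest i)) -[X in (X ^ _)%N]card_bool.
rewrite -[X in (_ ^ X)%N]card_ord -card_ffun -cardsT -cardsX.
apply: subset_leq_card; apply/subsetP => u; rewrite !inE.
by rewrite unfold_in.
Qed.

End Counting.

(** One application of [adjoin_roots] with exponent 1 per block; a block of k roots contributes k!
    generators. *)
Lemma adjoin_blocks (r : nat) (B : comNzRingType) (X : 'I_r -> seq B)
    (s : seq 'I_r) : forall (C : comNzRingType) (psi : {rmorphism C -> B})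
    (g : 'I_r -> {poly C}),
  (forall i, g i \is monic) ->
  (forall i, map_poly psi (g i) = \prod_(y <- X i) ('X - y%:P)) ->
  exists (C' : comNzRingType) (psi' : {rmorphism C' -> B})
    (iota : {rmorphism C -> C'}) (I : finType) (e : I -> B),
  [/\ #|I| = (\prod_(i <- s) (size (X i))`!)%N,
      forall c, psi' (iota c) = psi c,
      forall i y, i \in s -> y \in X i -> exists c, psi' c = y &
      forall c, spans psi e (psi' c)].
Proof.
elim: s => [|i s IH] C psi g gm gE.
  exists C, psi, idfun, unit, (fun=> 1); split=> //.
    by rewrite card_unit big_nil.
  by move=> c; exists (fun=> c); rewrite (big_pred1 tt) ?mulr1 //; case.
have [|C1 [psi1 [iota1 [I1 [e1 [cI1 iota1E X1 sp1]]]]]] :=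
  @adjoin_roots 1 B (X i) isT C psi (g i) (gm i).
  by rewrite gE; apply: eq_bigr => y _; rewrite expr1.
have [||C2 [psi2 [iota2 [I2 [e2 [cI2 iota2E X2 sp2]]]]]] :=
  IH C1 psi1 (fun i => map_poly iota1 (g i)).
- by move=> j; rewrite monic_map.
- move=> j; rewrite -gE -map_poly_comp.
  by apply: eq_map_poly => c /=; rewrite iota1E.
exists C2, psi2, (iota2 \o iota1), (I1 * I2)%type,
  (fun k : I1 * I2 => e1 k.1 * e2 k.2); split.
- by rewrite card_prod cI1 cI2 big_cons exp1n mul1n.
- by move=> c /=; rewrite iota2E iota1E.
- move=> j y; rewrite inE => /predU1P[->|js] yX; last exact: (X2 j).
  by have [c <-] := X1 y yX; exists (iota2 c); rewrite iota2E.
- by move=> c; apply: (spans_tower sp1) (sp2 c).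
Qed.

Section PolyIdentities.
Variable R : comNzRingType.

Lemma mul_pstar_roots (x : seq R) :
  (\prod_(y <- x) ('X - y%:P)) * pstar (\prod_(y <- x) ('X - y%:P)) =
  \prod_(y <- x) ('X^2 - (y ^+ 2)%:P).
Proof.
have E : pstar (\prod_(y <- x) ('X - y%:P)) = \prod_(y <- x) ('X + y%:P).
  rewrite /pstar size_prod_XsubC -[_.-1]/(size x); elim: x => [|y x IH].
    by rewrite !big_nil comp_polyC scale1r.
  rewrite !big_cons comp_polyM -IH -[size _]/(size x).+1 exprS -scalerA.
  rewrite [_ ^+ _ *: (_ * _)]scalerAr scalerAl.
  by rewrite comp_polyB comp_polyX comp_polyC scaleN1r opprD !opprK.
rewrite E -big_split; apply: eq_bigr => y _ /=.
by rewrite -subr_sqr rmorphXn.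
Qed.
End PolyIdentities.

(** * Evaluation of the universal factors at blocks of roots *)

Section Evaluation.
Import Pdiv.CommonRing Pdiv.RingMonic.
Variables (A : comNzRingType) (r : nat) (n_ : 'I_r -> nat) (n : nat).
Local Notation N := (\sum_(i < r) n_ i)%N.
Local Notation S := {mpoly A[N]}.
Variables (F : {poly A}) (B : comNzRingType) (phi : {rmorphism A -> B}).
Variable x : seq B.
Hypotheses (Fm : F \is monic) (sF : size F = n.+1) (n_le : (N <= n)%N).
Hypotheses (sx : size x = n)
  (FE : map_poly phi F = \prod_(y <- x) ('X - (y ^+ 2)%:P)).
Local Notation J := (PFiso_ideal n_ (F \Po 'X^2)).
Local Notation f := (F \Po 'X^2).

Definition block_roots (i : 'I_r) : seq B :=
  [seq x`_(tagnat.Rank i j) | j <- enum 'I_(n_ i)].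

Lemma size_block_roots i : size (block_roots i) = n_ i.
Proof. by rewrite size_map size_enum_ord. Qed.

Definition block_poly (i : 'I_r) : {poly B} :=
  \prod_(y <- block_roots i) ('X - y%:P).

Lemma size_block_poly i : size (block_poly i) = (n_ i).+1.
Proof. by rewrite size_prod_XsubC size_block_roots. Qed.

Lemma monic_block_poly i : block_poly i \is monic.
Proof. exact: monic_prod_XsubC. Qed.

(** Sends c_{i,j} to the coefficient that turns g_i into the product of X - y over the i-th block of
    roots. *)
Definition root_eval : {rmorphism S -> B} :=
  mmap phi (fun k => (block_poly (tagnat.sig1 k))`_(n_ (tagnat.sig1 k) -
    (tagnat.sig2 k).+1)).

Lemma root_evalC a : root_eval a%:MP = phi a.
Proof. exact: mmapC. Qed.

Lemma root_eval_gfactor i : map_poly root_eval (gfactor A n_ i) = block_poly i.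
Proof.
apply/polyP => k; rewrite coef_map coef_gfactor.
case: ltngtP => [kn|nk|->].
- have lt_j : (n_ i - k.+1 < n_ i)%N by lia.
  have -> : (n_ i - k = (Ordinal lt_j).+1)%N by rewrite /=; lia.
  rewrite cmonS /= mmapX mmap1U val_sig2_Rank tagnat.Rank1K /=.
  by congr (block_poly i)`_ _; lia.
- by rewrite raddf0 nth_default // size_block_poly.
- rewrite subnn cmon0 mpolyX0; apply: etrans (rmorph1 root_eval) _; apply/esym.
  by move/monicP: (monic_block_poly i); rewrite /lead_coef size_block_poly.
Qed.

Lemma root_eval_divisor : map_poly root_eval (PFiso_divisor A n_) =
  \prod_(y <- take N x) ('X^2 - (y ^+ 2)%:P).
Proof.
have mapP i : map_poly root_eval (pstar (gfactor A n_ i)) = pstar (block_poly i).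
  rewrite /pstar size_gfactor size_block_poly /= linearZ /= rmorphXn rmorphN1.
  by rewrite map_comp_poly root_eval_gfactor rmorphN /= map_polyX.
rewrite /PFiso_divisor rmorphM !rmorph_prod -big_split /=.
under eq_bigr => i _ do rewrite root_eval_gfactor mapP mul_pstar_roots.
rewrite (big_nth 0) size_takel ?sx // big_mkord.
rewrite (reindex _ (@tagnat.rank_bij_on r n_)).
transitivity (\prod_(i < r) \prod_(j < n_ i)
    ('X^2 - (x`_(tagnat.Rank i j) ^+ 2)%:P)).
  by apply: eq_bigr => i _; rewrite big_map big_enum.
rewrite sig_big_dep; apply: eq_bigr => p _.
by rewrite nth_take ?ltn_ord // -tagnat.rankE.
Qed.

Lemma root_eval_f : map_poly root_eval (map_poly (@mpolyC N A) f) =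
  \prod_(y <- x) ('X^2 - (y ^+ 2)%:P).
Proof.
rewrite -map_poly_comp (eq_map_poly (g := phi)) => [|a]; last exact: root_evalC.
rewrite map_comp_poly FE map_polyXn rmorph_prod; apply: eq_bigr => y _ /=.
by rewrite comp_polyB comp_polyX comp_polyC.
Qed.

Lemma monic_divisor : PFiso_divisor A n_ \is monic.
Proof. by rewrite PFiso_divisorE monic_comp_X2 // monic_hprod. Qed.

(** The divisor is sent to the product over the first N roots, which divides the image of f;
    remainders by monic divisors commute with ring maps. *)
Lemma root_eval_ideal p : J p -> root_eval p = 0.
Proof.
move=> [s sJ ->]; rewrite rmorph_sum big_seq big1 // => t /sJ[k ->].
rewrite rmorphM /= -[X in _ * X]coef_map map_rmodp_monic ?monic_divisor //.
rewrite root_eval_f root_eval_divisor.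
rewrite -[X in \prod_(y <- X) _](cat_take_drop N x) big_cat /=.
rewrite [\prod_(y <- take N x) _ * _]mulrC rmodp_mull ?coef0 ?mulr0 //.
by case: (size_prod_XnsubC (take N x) (isT : (0 < 2)%N)).
Qed.

Hypothesis gen : forall P : B -> Prop, (forall a b, P a -> P b -> P (a + b)) ->
  (forall a b, P a -> P b -> P (a * b)) -> (forall a, P (phi a)) ->
  (forall y, y \in x -> P y) -> forall b, P b.

(** The roots of each block are adjoined first, with exponent 1; the other n - N roots are then
    adjoined through the quotient of f by the divisor, with exponent 2. The two counts multiply. *)
Lemma spans_root_eval : exists (I : finType) (e : I -> B),
  #|I| = ((\prod_(i < r) (n_ i)`!) * (2 ^ (n - N) * (n - N)`!))%N /\
  forall b, spans root_eval e b.
Proof.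
have [C1 [psi1 [iota1 [I1 [e1 [cI1 iota1E X1 sp1]]]]]] :=
  adjoin_blocks (X := block_roots) (index_enum 'I_r)
    (fun i => monic_gfactor A n_ i) root_eval_gfactor.
pose P1 := map_poly iota1 (PFiso_divisor A n_).
pose f1 := map_poly iota1 (map_poly (@mpolyC N A) f).
have psi1E (q : {poly S}) :
    map_poly psi1 (map_poly iota1 q) = map_poly root_eval q.
  by rewrite -map_poly_comp; apply: eq_map_poly => c /=; rewrite iota1E.
have P1m : P1 \is monic by rewrite monic_map // monic_divisor.
have f1m : f1 \is monic by rewrite !monic_map // monic_comp_X2.
have sP1 : size P1 = N.*2.+1.
  rewrite size_monic_map ?monic_divisor // PFiso_divisorE.
  exact: size_comp_X2 (size_hprod A n_).
have sf1 : size f1 = n.*2.+1.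
  rewrite size_monic_map ?monic_map ?monic_comp_X2 //.
  rewrite size_monic_map ?monic_comp_X2 //; exact: size_comp_X2.
have um : rdivp f1 P1 \is monic by rewrite rdivp_monic // sP1 sf1 ltnS leq_double.
have uE : map_poly psi1 (rdivp f1 P1) =
    \prod_(y <- drop N x) ('X^2 - (y ^+ 2)%:P).
  rewrite map_rdivp_monic // !psi1E root_eval_f root_eval_divisor.
  rewrite -{1}(cat_take_drop N x) big_cat /= mulrC rdivp_mull //.
  by case: (size_prod_XnsubC (take N x) (isT : (0 < 2)%N)).
have [C2 [psi2 [iota2 [I2 [e2 [cI2 iota2E X2 sp2]]]]]] :=
  adjoin_roots (isT : (0 < 2)%N) um uE.
exists (I1 * I2)%type, (fun k : I1 * I2 => e1 k.1 * e2 k.2); split.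
  rewrite card_prod cI1 cI2 size_drop sx; congr (_ * _)%N.
  by apply: eq_bigr => i _; rewrite size_block_roots.
(* All roots and the image of [phi] lie in the image of [psi2], which by [gen] is therefore all of
   [B]. *)
suff surj b : exists c, psi2 c = b.
  by move=> b; have [c <-] := surj b; exact: spans_tower sp1 _ (sp2 c).
apply: (gen (P := fun b => exists c, psi2 c = b)).
- by move=> _ _ [c <-] [c' <-]; exists (c + c'); rewrite rmorphD.
- by move=> _ _ [c <-] [c' <-]; exists (c * c'); rewrite rmorphM.
- move=> a; exists (iota2 (iota1 a%:MP)).
  by rewrite iota2E iota1E root_evalC.
- move=> y; rewrite -{1}(cat_take_drop N x) mem_cat => /orP[yt|]; last exact: X2.
  have /nthP -/(_ 0)[k] := yt; rewrite size_takel ?sx // => lt_k <-.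
  rewrite nth_take //; pose k' := Ordinal lt_k.
  have [||c cE] := X1 (tagnat.sig1 k') x`_k.
  + exact: mem_index_enum.
  + apply/mapP; exists (tagnat.sig2 k'); first by rewrite mem_enum.
    by rewrite tagnat.sig2K.
  by exists (iota2 c); rewrite iota2E.
Qed.

End Evaluation.

(** * Linear independence modulo the ideal *)

Section Independence.
Variables (A : comNzRingType) (r : nat) (n_ : 'I_r -> nat) (n : nat).
Local Notation N := (\sum_(i < r) n_ i)%N.
Local Notation S := {mpoly A[N]}.
Local Notation b := (N * n.*2.+1).+1.
Local Notation K := {m : 'X_{1..N < b} | standard n (val m)}.

(** Each exponent has half at most n, so each of the N exponents is at most 2n + 1. *)
Lemma mdeg_standard (m : 'X_{1..N}) : standard n m -> (mdeg m < b)%N.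
Proof.
move=> /forallP std_m; rewrite ltnS mdegE -[X in (_ <= X * _)%N]card_ord.
rewrite -sum_nat_const; apply: leq_sum => k _.
have := std_m (tagnat.sig1 k); rewrite (bigD1 (tagnat.sig2 k)) //= mnmE.
rewrite tagnat.sig2K; move: (m k) => a; move: (\sum_(j | _) _)%N => s le_n.
have : (a./2 <= n)%N by rewrite (leq_trans (leq_addr s _)) // (leq_trans le_n) // leq_subr.
lia.
Qed.

Lemma standard_expand (p : S) : {in msupp p, forall m, standard n m} ->
  p = \sum_(k : K) p@_(val (val k)) *: 'X_[val (val k)].
Proof.
move=> std_p; apply/mpolyP => m; rewrite raddf_sum /=.
rewrite [RHS](eq_bigr (fun k : K =>
  p@_(val (val k)) * (val (val k) == m)%:R)) => [|k _]; last first.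
  by rewrite mcoeffZ mcoeffX.
have [mp|mp] := boolP (m \in msupp p).
  have std_m := std_p m mp.
  pose k0 : K := exist _ (BMultinom (mdeg_standard std_m)) std_m.
  rewrite [RHS](bigD1 k0) //= eqxx mulr1 [X in _ + X]big1 ?addr0 // => k nk.
  rewrite (_ : (_ == m) = false) ?mulr0 //; apply/negP => /eqP km.
  by case/eqP: nk; apply/val_inj/val_inj.
rewrite [RHS]big1 ?(memN_msupp_eq0 mp) // => k _.
by case: eqP => [->|_]; rewrite ?mulr0 // (memN_msupp_eq0 mp) mul0r.
Qed.

Variable F : {poly A}.
Hypotheses (Fm : F \is monic) (sF : size F = n.+1) (n_le : (N <= n)%N).
Local Notation J := (PFiso_ideal n_ (F \Po 'X^2)).

Lemma card_standard_factorials (I : finType) :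
  #|I| = ((\prod_(i < r) (n_ i)`!) * (2 ^ (n - N) * (n - N)`!))%N ->
  (#|{: K * I}| <= 2 ^ n * n`!)%N.
Proof.
move=> cI; rewrite card_prod cI.
apply: leq_trans (leq_mul (card_standard n_ n b) (leqnn _)) _.
have pow2 : (2 ^ n = 2 ^ N * 2 ^ (n - N))%N by rewrite -expnD subnKC.
rewrite -(prod_binomials n_le) !big_split /= -expn_sum pow2.
move: (\prod_(i < r) 'C(_, _))%N (\prod_(i < r) _`!)%N => a c.
by rewrite -!mulnA leq_mul2l (mulnCA c) (mulnCA a) leqnn orbT.
Qed.

(** The images of the standard monomials times the family [e] span [B] and number at most its rank
    2^n n!, so they are free over [A]; an element of J is sent to 0 and thus yields a relation. *)
Lemma standard_free (p : S) :
  J p -> {in msupp p, forall m, standard n m} -> p = 0.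
Proof.
move=> pJ std_p.
have [B [phi [x [I0 [e0 [[sx FE] cI0 span_e0 free_e0 gen]]]]]] :=
  splitting_ring Fm sF.
have [I [e [cI span_e]]] := spans_root_eval Fm sF n_le sx FE gen.
pose psi := root_eval n_ phi x.
have psi0 := root_eval_ideal Fm sF n_le sx FE.
have psiE (q : S) : {in msupp q, forall m, standard n m} ->
    psi q = \sum_(k : K) phi q@_(val (val k)) * psi 'X_[val (val k)].
  move=> std_q; rewrite [in LHS](standard_expand std_q) rmorph_sum.
  by apply: eq_bigr => k _; rewrite -mul_mpolyC rmorphM root_evalC.
have span_K (q : S) : spans phi (fun k : K => psi 'X_[val (val k)]) (psi q).
  have [p' [p'J p'std]] := standard_reduction Fm sF n_le q.
  exists (fun k : K => p'@_(val (val k))); rewrite -psiE => [|m /p'std[] //].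
  by apply/eqP; rewrite -subr_eq0 -rmorphB /=; apply/eqP; exact: psi0.
have card_KI : (#|{: K * I}| <= #|I0|)%N.
  by rewrite cI0; exact: card_standard_factorials.
have free_KI := spanning_free free_e0 span_e0
  (fun b => spans_tower span_K (span_e b)) card_KI.
(* The family [e] is nonempty; psi(p) e_{i0} = 0 is a relation supported on the products with
   [e i0], and freeness kills the coefficients of [p]. *)
have [i0 _] : exists i0 : I, i0 \in I.
  apply/card_gt0P; rewrite cI !muln_gt0 expn_gt0 fact_gt0 !andbT.
  by apply: prodn_gt0 => i; exact: fact_gt0.
rewrite (standard_expand std_p) [LHS]big1 // => k _.
have := free_KI (fun ki => if ki.2 == i0 then p@_(val (val ki.1)) else 0) _ (k, i0).
rewrite /= eqxx => -> //; first by rewrite scale0r.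
rewrite -(pair_bigA _ (fun (k : K) (i : I) =>
  phi (if i == i0 then p@_(val (val k)) else 0) *
  (psi 'X_[val (val k)] * e i))) /=.
transitivity (psi p * e i0); last by rewrite psi0 // mul0r.
rewrite psiE // mulr_suml; apply: eq_bigr => k' _.
rewrite [LHS](bigD1 i0) //= eqxx [X in _ + X]big1 ?addr0 ?mulrA // => i ni.
by rewrite (negPf ni) rmorph0 mul0r.
Qed.

End Independence.

Theorem theorem7p6 (A : comNzRingType) (n : nat) (f : {poly A})
    (f_monic : f \is monic) (f_size : size f = (2 * n).+1%N)
    (f_even : forall k : nat, odd k -> f`_k = 0)
    (r : nat) (n_ : 'I_r -> nat) (n_le : (\sum_(i < r) n_ i <= n)%N)
    (p : {mpoly A[(\sum_(i < r) n_ i)%N]}) :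
  lead_ideal n_ (PFiso_ideal n_ f) p <->
  ideal_sum (fun i : 'I_r =>
    ideal_Sq (ideal_pow (block_ideal A n_ i)
      (n - \sum_(j < r | (i <= j)%N) n_ j + 1)%N)) p.
Proof.
(* Having no terms of odd degree, [f] is its even part F evaluated at x^2. *)
have fE : f = even_poly f \Po 'X^2.
  rewrite -{1}(poly_even_odd f) (_ : odd_poly f = 0) ?comp_poly0 ?mul0r ?addr0 //.
  by apply/polyP => k; rewrite coef_odd_poly coef0 f_even //= odd_double.
have sF : size (even_poly f) = n.+1.
  by rewrite size_even_poly_eq f_size mul2n /= ?odd_double // doubleK.
have Fm : even_poly f \is monic.
  apply/monicP; rewrite /lead_coef sF coef_even_poly -mul2n.
  by move/monicP: f_monic; rewrite /lead_coef f_size.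
rewrite fE; split; last exact: squares_in_lead.
apply: lead_in_squares => // q; exact: standard_free.
Qed.
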